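(* Let $U$ be a smooth function on $(0,\infty)$ and let $u(\cdot)=U(|\cdot|)$ be the corresponding radial function on $\mathbb{R}^N$. Let $m\ge1$ be an integer. (i) If $N\ge 2m-1$ and $\left(\frac{U'(r)}{r}\right)^{(2m-2)}r^{\frac N2}\to0$ both as $r\to0^+$ and as $r\to\infty$, then $$\int_{\mathbb{R}^N}|\Delta^m u|^2\,dx\ \ge\ |\mathbb{S}^{N-1}|\int_0^\infty\left|U^{(2m)}(r)\right|^2r^{N-1}\,dr .$$ (ii) If $N\ge 2m$ and $\left(\frac{U'(r)}{r}\right)^{(2m-1)}r^{\frac N2}\to0$ both as $r\to0^+$ and as $r\to\infty$, then $$\int_{\mathbb{R}^N}|\nabla\Delta^m u|^2\,dx\ \ge\ |\mathbb{S}^{N-1}|\int_0^\infty\left|U^{(2m+1)}(r)\right|^2r^{N-1}\,dr .$$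
   Context: $N\ge1$ is an integer. A superscript $(j)$ denotes the $j$-th derivative with respect to $r$; e.g. $\left(\frac{U'(r)}{r}\right)^{(2m-2)}$ is the $(2m-2)$-th derivative of the function $r\mapsto U'(r)/r$. $|\mathbb{S}^{N-1}|$ is the surface measure of the unit sphere in $\mathbb{R}^N$. *)

(* Defs.v *)
From HB Require Import structures.
From mathcomp Require Import all_boot all_order all_algebra.
From mathcomp Require Import all_classical all_reals all_analysis.

Set Implicit Arguments.
Unset Strict Implicit.
Unset Printing Implicit Defensive.

Import Order.TTheory GRing.Theory Num.Theory.
Import numFieldNormedType.Exports.

Local Open Scope ring_scope.
Local Open Scope classical_set_scope.

(* Lebesgue measure on R^n, carried by n-tuples with their product Borel
   sigma-algebra: the n-fold product of the Lebesgue measure on R. *)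
Section lebesgue_tuple.
Variable R : realType.

Definition tcons (n : nat) (p : measurableTypeR R * n.-tuple (measurableTypeR R)) :
    n.+1.-tuple (measurableTypeR R) := [tuple of p.1 :: p.2].

Definition tuncons (n : nat) (t : n.+1.-tuple (measurableTypeR R)) :
    measurableTypeR R * n.-tuple (measurableTypeR R) :=
  (thead t, [tuple of behead t]).

Lemma tconsK (n : nat) : cancel (@tcons n) (@tuncons n).
Proof. by move=> [x t]; congr pair; apply: val_inj. Qed.

Lemma measurable_tcons (n : nat) : measurable_fun [set: _] (@tcons n).
Proof. by apply: measurable_cons. Qed.

Lemma measurable_tuncons (n : nat) : measurable_fun [set: _] (@tuncons n).
Proof.
apply: measurable_fun_pair; last exact: measurable_behead.
exact: measurable_tnth.
Qed.

Section step.
Variables (n : nat)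
  (mu : {sigma_finite_measure set (n.-tuple (measurableTypeR R)) -> \bar R}).

Let prodm : {measure set
    (measurableTypeR R * n.-tuple (measurableTypeR R))%type -> \bar R} :=
  (@lebesgue_measure R \x mu)%E.

Definition lebesgue_step := pushforward (@lebesgue_measure R \x mu)%E (@tcons n).

Let stepE A : lebesgue_step A = prodm (@tcons n @^-1` A).
Proof. by []. Qed.

Let step0 : lebesgue_step set0 = 0%E.
Proof. by rewrite stepE preimage_set0 measure0. Qed.

Let step_ge0 A : (0 <= lebesgue_step A)%E.
Proof. by rewrite stepE measure_ge0. Qed.

Let mtcons A : measurable A -> measurable (@tcons n @^-1` A).
Proof. by move=> mA; rewrite -[X in measurable X]setTI; exact: measurable_tcons. Qed.

Let step_sigma_additive : semi_sigma_additive lebesgue_step.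
Proof.
move=> F mF tF mUF; rewrite stepE preimage_bigcup.
apply: (@measure_semi_sigma_additive _ _ _ prodm).
- by move=> k; exact: mtcons.
- apply/trivIsetP => /= i j _ _ ij; rewrite -preimage_setI.
  by move/trivIsetP : tF => /(_ _ _ _ _ ij) ->//; rewrite preimage_set0.
- by rewrite -preimage_bigcup; exact: mtcons.
Qed.

HB.instance Definition _ := isMeasure.Build _ _ _ lebesgue_step
  step0 step_ge0 step_sigma_additive.

Let step_sigma_finite : sigma_finite setT lebesgue_step.
Proof.
have /sigma_finiteP[F [FT ndF F_oo]] := sigma_finiteT (@lebesgue_measure R).
have /sigma_finiteP[G [GT ndG G_oo]] := sigma_finiteT mu.
exists (fun k => @tuncons n @^-1` (F k `*` G k)).
  apply/seteqP; split => // t _.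
  have [i _ Fi] : (\bigcup_i F i) (tuncons t).1 by rewrite -FT.
  have [j _ Gj] : (\bigcup_i G i) (tuncons t).2 by rewrite -GT.
  exists (maxn i j) => //; split.
  - by move: Fi; exact/subsetPset/ndF/leq_maxl.
  - by move: Gj; exact/subsetPset/ndG/leq_maxr.
move=> k; have [mF Foo] := F_oo k; have [mG Goo] := G_oo k; split.
  by rewrite -[X in measurable X]setTI; apply: measurable_tuncons => //;
    exact: measurableX.
rewrite stepE (_ : _ @^-1` _ = F k `*` G k).
  by rewrite /prodm /= product_measure1E// lte_mul_pinfty// ge0_fin_numE.
rewrite -comp_preimage (_ : @tuncons n \o @tcons n = id) ?preimage_id//.
by apply/funext => x; exact: tconsK.
Qed.

HB.instance Definition _ := Measure_isSigmaFinite.Build _ _ _ lebesgue_step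
  step_sigma_finite.

End step.

Fixpoint lebesgue_tuple (n : nat) :
    {sigma_finite_measure set (n.-tuple (measurableTypeR R)) -> \bar R} :=
  match n with
  | 0 => @dirac _ _ ([tuple] : 0.-tuple (measurableTypeR R)) R
  | n'.+1 => lebesgue_step (lebesgue_tuple n')
  end.

End lebesgue_tuple.

Section euclidean_calculus.
Variables (R : realType) (N : nat).
Implicit Types (f : 'rV[R]_N -> R) (x : 'rV[R]_N).

Definition row_of_tuple (t : N.-tuple (measurableTypeR R)) : 'rV[R]_N :=
  \row_i tnth t i.

(* The library norm `|x| on 'rV[R]_N is the sup norm. *)
Definition enorm x : R := Num.sqrt (\sum_i x ord0 i ^+ 2).

Definition radial (U : R -> R) x : R := U (enorm x).

Definition partial (i : 'I_N) f x : R := 'D_(delta_mx ord0 i) f x.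

Definition grad f x : 'rV[R]_N := \row_i partial i f x.

Definition laplacian f x : R := \sum_i partial i (partial i f) x.

Definition unit_sphere : set 'rV[R]_N := [set x | enorm x = 1].

Definition cone (A : set 'rV[R]_N) : set 'rV[R]_N :=
  [set y | exists2 x, A x & exists2 s : R, 0 < s <= 1 & y = s *: x].

(* For A a subset of the unit sphere; with this normalization
   dx = r^(N-1) dr dsigma in polar coordinates. *)
Definition surface_measure (A : set 'rV[R]_N) : \bar R :=
  (N%:R%:E * lebesgue_tuple R N (row_of_tuple @^-1` cone A))%E.

End euclidean_calculus.

Arguments unit_sphere R N : clear implicits.

Definition smooth_on_pos (R : realType) (U : R -> R) : Prop :=
  forall (n : nat) (r : R), 0 < r -> derivable (U^`(n)) r 1.

(* Main.v *)
(* With V = U'/r, the radial Laplacian is L U = r V' + N V while U' = r V, so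
   for Z = V^(k-2)
     U^(k) = r Z' + (k-1) Z  and  (L U)^(k-2) = r Z' + (N+k-2) Z.
   The difference of their squares times r^(N-1) is
   (N-1) (r^N Z^2)' + (N-1) (2k-3) r^(N-1) Z^2, so
   int |U^(k)|^2 r^(N-1) <= int |(L U)^(k-2)|^2 r^(N-1) as soon as r^N Z^2 -> 0
   at 0; the boundary term at infinity has the favourable sign. When the right
   side is finite, writing (r^a Z)' = r^(a-1) (L U)^(k-2) with a = N+k-2 and
   using Cauchy-Schwarz bounds r^N Z^2 by the part of that integral over ]0, r],
   so that the weaker r^N Z -> 0 is enough.
   This weaker condition passes from U to L U: let K be the order of the
   derivative of U in the theorem. Since V(L U) = V'' + (N+1) V'/r, all the
   conditions needed follow from r^(N-i) V^(K-2-i) -> 0 for i <= K-2, which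
   results from integrating r^N V^(K-2) -> 0 repeatedly because N >= K-1.
   Iterating m times gives the one-dimensional inequality, and polar coordinates
   transfer it to R^N. *)
Require Import Defs.
From mathcomp Require Import all_boot all_order all_algebra.
From mathcomp Require Import all_classical all_reals all_analysis.
From mathcomp Require Import measurable_realfun.
From mathcomp Require Import ring lra zify.
Import Order.TTheory GRing.Theory Num.Theory.
Import numFieldNormedType.Exports.
Local Open Scope ring_scope.
Local Open Scope classical_set_scope.

Set Implicit Arguments.
Unset Strict Implicit.
Unset Printing Implicit Defensive.

(** * Derivatives on the positive half-line *)

Section calculus_on_pos.
Context {R : realType}.
Implicit Types (f g : R -> R) (n : nat) (r c : R).

(** Only values on the open half-line matter. Derivatives at [r > 0] are local, so an identity of
    this kind can be differentiated any number of times, whatever happens at [r <= 0]. *)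
Definition eqpos f g := forall r, 0 < r -> f r = g r.

Lemma near_pos (P : R -> Prop) r : (forall s, 0 < s -> P s) -> 0 < r ->
  \forall s \near r, P s.
Proof.
by move=> PP r0; near=> s; apply: PP; near: s; exact: lt_nbhsr.
Unshelve. all: by end_near. Qed.

Lemma eqpos_derive1 f g : eqpos f g -> eqpos f^`() g^`().
Proof.
by move=> fg r r0; rewrite !derive1E; apply: near_eq_derive; exact: near_pos.
Qed.

Lemma eqpos_derive1n n f g : eqpos f g -> eqpos f^`(n) g^`(n).
Proof.
by move=> fg; elim: n => [//|n IH]; rewrite !derive1nS; exact: eqpos_derive1.
Qed.

Lemma eqpos_derivable f g r : eqpos f g -> 0 < r -> derivable f r 1 ->
  derivable g r 1.
Proof. by move=> fg r0; apply: near_eq_derivable; exact: near_pos. Qed.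

(** A finite order makes induction possible: in (f g)' = f' g + f g' each product has factors smooth
    to one order less, so closure under products passes from n to n+1. *)
Definition smooth_upto n f := forall k, (k <= n)%N -> forall r, 0 < r ->
  derivable f^`(k) r 1.

Lemma smooth_uptoS n f : smooth_upto n.+1 f <->
  (forall r, 0 < r -> derivable f r 1) /\ smooth_upto n f^`().
Proof.
split=> [sf|[f0 sf] [|k] kn r r0]; first split=> [r r0|k kn r r0].
- exact: (sf 0%N).
- by rewrite -derive1Sn; exact: sf.
- exact: f0.
- by rewrite derive1Sn; exact: sf.
Qed.

Lemma smooth_upto0 f : smooth_upto 0 f <-> forall r, 0 < r -> derivable f r 1.
Proof.
by split=> [sf r r0|sf k]; [exact: (sf 0%N)|rewrite leqn0 => /eqP -> r r0; exact: sf].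
Qed.

Lemma smooth_upto_le n k f : (k <= n)%N -> smooth_upto n f -> smooth_upto k f.
Proof. by move=> kn sf j jk; apply: sf; exact: leq_trans kn. Qed.

Lemma smooth_uptoP f : smooth_on_pos f <-> forall n, smooth_upto n f.
Proof. by split=> [sf n k _|sf n]; [exact: sf|exact: (sf n n)]. Qed.

Lemma eqpos_smooth_upto n f g : eqpos f g -> smooth_upto n f -> smooth_upto n g.
Proof.
move=> fg sf k kn r r0; apply: (eqpos_derivable (f := f^`(k))) => //.
  exact: eqpos_derive1n.
exact: sf.
Qed.

Lemma is_derive_pos f r : derivable f r 1 -> is_derive r 1 f (f^`() r).
Proof. by move=> df; rewrite derive1E; exact: derivableP. Qed.

Lemma derive1_val {f : R -> R} {r d : R} : is_derive r 1 f d -> f^`() r = d.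
Proof. by move=> df; rewrite derive1E; exact: derive_val. Qed.

Lemma is_derive_ex f r d : is_derive r 1 f d -> derivable f r 1.
Proof. by case. Qed.

Lemma is_deriveMr f g r a b : is_derive r 1 f a -> is_derive r 1 g b ->
  is_derive r 1 (fun s => f s * g s) (a * g r + f r * b).
Proof.
move=> fa gb; rewrite [X in is_derive _ _ _ X](_ : _ = f r *: b + g r *: a).
  exact: is_deriveM.
by rewrite /GRing.scale/=; ring.
Qed.

Lemma is_deriveDr f g r a b : is_derive r 1 f a -> is_derive r 1 g b ->
  is_derive r 1 (fun s => f s + g s) (a + b).
Proof. by move=> fa gb; exact: is_deriveD. Qed.

Lemma is_deriveZr f r c a : is_derive r 1 f a ->
  is_derive r 1 (fun s => c * f s) (c * a).
Proof. by move=> fa; exact: is_deriveZ. Qed.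

Lemma is_deriveXr n r :
  is_derive r 1 (fun s : R => s ^+ n) (n%:R * r ^+ n.-1).
Proof.
case: n => [|n]; first by rewrite mul0r; exact: is_derive_cst.
have := is_deriveX n.+1 (is_derive_id r 1).
by rewrite exprfctE /GRing.scale/= mulr1.
Qed.

Lemma is_deriveVr r : 0 < r ->
  is_derive r 1 (fun s : R => s^-1) (- (r^-1 * r^-1)).
Proof.
move=> r0; rewrite [X in is_derive _ _ _ X](_ : _ = - (id r) ^- 2 *: 1).
  by apply: is_deriveV; rewrite gt_eqF.
by rewrite /GRing.scale/= mulr1 -exprVn expr2.
Qed.

Lemma smooth_uptoD n f g : smooth_upto n f -> smooth_upto n g ->
  smooth_upto n (fun r => f r + g r).
Proof.
elim: n f g => [|n IH] f g.
  move=> /smooth_upto0 df /smooth_upto0 dg; apply/smooth_upto0 => r r0.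
  by apply: is_derive_ex; apply: is_deriveDr; apply: is_derive_pos; auto.
move=> /smooth_uptoS[df sf] /smooth_uptoS[dg sg]; apply/smooth_uptoS; split=> [r r0|].
  by apply: is_derive_ex; apply: is_deriveDr; apply: is_derive_pos; auto.
apply: eqpos_smooth_upto (IH _ _ sf sg) => r r0.
by apply/esym/derive1_val; apply: is_deriveDr; apply: is_derive_pos; auto.
Qed.

Lemma smooth_uptoM n f g : smooth_upto n f -> smooth_upto n g ->
  smooth_upto n (fun r => f r * g r).
Proof.
elim: n f g => [|n IH] f g.
  move=> /smooth_upto0 df /smooth_upto0 dg; apply/smooth_upto0 => r r0.
  by apply: is_derive_ex; apply: is_deriveMr; apply: is_derive_pos; auto.
move=> sf sg; have sf' := smooth_upto_le (leqnSn n) sf.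
have sg' := smooth_upto_le (leqnSn n) sg.
move: sf sg => /smooth_uptoS[df sf] /smooth_uptoS[dg sg].
apply/smooth_uptoS; split=> [r r0|].
  by apply: is_derive_ex; apply: is_deriveMr; apply: is_derive_pos; auto.
apply: eqpos_smooth_upto (smooth_uptoD (IH _ _ sf sg') (IH _ _ sf' sg)) => r r0.
by apply/esym/derive1_val; apply: is_deriveMr; apply: is_derive_pos; auto.
Qed.

Lemma smoothD f g : smooth_on_pos f -> smooth_on_pos g ->
  smooth_on_pos (fun r => f r + g r).
Proof.
by move=> /smooth_uptoP sf /smooth_uptoP sg; apply/smooth_uptoP => n; apply: smooth_uptoD.
Qed.

Lemma smoothM f g : smooth_on_pos f -> smooth_on_pos g ->
  smooth_on_pos (fun r => f r * g r).
Proof.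
by move=> /smooth_uptoP sf /smooth_uptoP sg; apply/smooth_uptoP => n; apply: smooth_uptoM.
Qed.

Lemma smooth_derive1 f : smooth_on_pos f -> smooth_on_pos f^`().
Proof. by move=> sf n r r0; rewrite -derive1Sn; exact: sf. Qed.

Lemma smooth_derive1n n f : smooth_on_pos f -> smooth_on_pos f^`(n).
Proof. by move=> sf; elim: n => [|n IH]; [exact: sf|exact: (@smooth_derive1 f^`(n))]. Qed.

Lemma smooth_cst c : smooth_on_pos (fun=> c).
Proof.
suff H n : (fun=> c : R)^`(n) = fun=> if n is 0 then c else 0.
  by move=> n r _; rewrite H; exact: derivable_cst.
by elim: n => // n IH; rewrite derive1nS IH; apply/funext => r; exact: derive1_cst.
Qed.

Lemma smooth_id : smooth_on_pos (id : R -> R).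
Proof.
apply/smooth_uptoP => -[|n]; first by apply/smooth_upto0 => r _; exact: derivable_id.
apply/smooth_uptoS; split; first by move=> r _; exact: derivable_id.
have /smooth_uptoP/(_ n) := smooth_cst (c := 1).
by apply: eqpos_smooth_upto => r _; rewrite derive1E derive_id.
Qed.

Lemma smoothX n : smooth_on_pos (fun r : R => r ^+ n).
Proof.
elim: n => [|n IH]; first by under eq_fun do rewrite expr0; exact: smooth_cst.
by under eq_fun do rewrite exprS; exact: smoothM smooth_id IH.
Qed.

(** The derivative of [r^-1] is minus the product of [r^-1] with itself, so smoothness up to n
    yields smoothness up to n+1. *)
Lemma smoothV : smooth_on_pos (fun r : R => r^-1).
Proof.
apply/smooth_uptoP; elim=> [|n IH].
  by apply/smooth_upto0 => r /is_deriveVr/is_derive_ex.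
apply/smooth_uptoS; split=> [r /is_deriveVr/is_derive_ex//|].
have /smooth_uptoP/(_ n) s1 := smooth_cst (c := -1).
apply: eqpos_smooth_upto (smooth_uptoM s1 (smooth_uptoM IH IH)) => r r0.
by rewrite mulN1r; apply/esym/derive1_val/is_deriveVr.
Qed.

Lemma smooth_derivable f r : smooth_on_pos f -> 0 < r -> derivable f r 1.
Proof. by move=> sf; exact: (sf 0%N). Qed.

Lemma smooth_is_derive f r : smooth_on_pos f -> 0 < r -> is_derive r 1 f (f^`() r).
Proof. by move=> sf r0; apply: is_derive_pos; exact: smooth_derivable. Qed.

Lemma smooth_continuous f r : smooth_on_pos f -> 0 < r -> {for r, continuous f}.
Proof.
by move=> sf r0; apply/differentiable_continuous/derivable1_diffP; exact: smooth_derivable.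
Qed.

Lemma derive1nD n f g : smooth_on_pos f -> smooth_on_pos g ->
  eqpos (fun r => f r + g r)^`(n) (fun r => f^`(n)%classic r + g^`(n)%classic r).
Proof.
move=> sf sg; elim: n => // n IH r r0.
rewrite !derive1nS (eqpos_derive1 IH)//; apply/derive1_val.
exact: is_deriveDr (smooth_is_derive (smooth_derive1n (n := n) sf) r0)
  (smooth_is_derive (smooth_derive1n (n := n) sg) r0).
Qed.

Lemma derive1nZ n f c : smooth_on_pos f ->
  eqpos (fun r => c * f r)^`(n) (fun r => c * f^`(n)%classic r).
Proof.
move=> sf; elim: n => // n IH r r0.
rewrite !derive1nS (eqpos_derive1 IH)//; apply/derive1_val.
exact: is_deriveZr (smooth_is_derive (smooth_derive1n (n := n) sf) r0).
Qed.

(** Leibniz rule with a linear factor: only two terms survive. At [n = 0] the default [n.-1 = 0] is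
    harmless, its coefficient being zero. *)
Lemma derive1n_idM n f : smooth_on_pos f ->
  eqpos (fun r => r * f r)^`(n) (fun r => r * f^`(n)%classic r + n%:R * f^`(n.-1)%classic r).
Proof.
move=> sf; elim: n => [|n IH] r r0; first by rewrite mul0r addr0.
rewrite derive1nS (eqpos_derive1 IH)//; apply/derive1_val.
have d1 := smooth_is_derive (smooth_derive1n (n := n) sf) r0.
have d2 := smooth_is_derive (smooth_derive1n (n := n.-1) sf) r0.
have := is_deriveDr (is_deriveMr (is_derive_id r 1) d1) (is_deriveZr n%:R d2).
congr is_derive; rewrite -!derive1nS /= -natr1.
case: n {IH d1 d2} => [|n]; rewrite /=; ring.
Qed.

End calculus_on_pos.

(** * Decay at zero *)

Section vanishing_at_zero.
Context {R : realType}.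
Implicit Types (f g F : R -> R) (n c k : nat) (r x y : R).

Lemma near0_pos (P : R -> Prop) : (forall s, 0 < s -> P s) ->
  \forall s \near (0 : R)^'+, P s.
Proof.
by move=> PP; near=> s; apply: PP; near: s; exact: nbhs_right_gt.
Unshelve. all: by end_near. Qed.

Lemma eqpos_cvg0 f g : eqpos f g ->
  f r @[r --> 0^'+] --> (0 : R) -> g r @[r --> 0^'+] --> (0 : R).
Proof. by move=> fg; apply: cvg_trans; apply: near_eq_cvg; exact: near0_pos. Qed.

Lemma cvg0X n : (r : R) ^+ n.+1 @[r --> 0^'+] --> (0 : R).
Proof.
apply: cvg_at_right_filter; rewrite -[X in _ --> X](expr0n _ n.+1).
exact: exprn_continuous.
Qed.

Lemma pos_derive1_ge0_le (F : R -> R) x y : 0 < x -> x <= y ->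
  (forall s, 0 < s -> derivable F s 1) ->
  (forall s, x < s < y -> 0 <= F^`()%classic s) -> F x <= F y.
Proof.
move=> x0 xy dF F0.
have pos s : s \in `[x, y]%R -> 0 < s.
  by rewrite in_itv/= => /andP[xs _]; exact: lt_le_trans xs.
have := @ger0_derive1_le_cc _ F x y; apply; rewrite ?bound_itvE//.
- by move=> s /subset_itv_oo_cc /pos; exact: dF.
- by apply: derivable_within_continuous => s /pos; exact: dF.
Qed.

Lemma is_deriveVX n (r : R) : 0 < r ->
  is_derive r 1 (fun s : R => s^-1 ^+ n.+1) (- n.+1%:R * r^-1 ^+ n.+2).
Proof.
move=> r0; have := is_derive1_comp (is_deriveXr n.+1 r^-1) (is_deriveVr r0).
by congr is_derive; rewrite /= [in RHS]exprS [in RHS]exprS; ring.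
Qed.

(** Near 0 the derivative is at most (e/2) (n+1) r^-(n+2) in absolute value. Integrating from r to a
    fixed r0 gives |f(r)| <= |f(r0)| + (e/2) r^-(n+1), which is then multiplied by r^(n+1). *)
Lemma cvg0_integrate n f : smooth_on_pos f ->
  r ^+ n.+2 * f^`()%classic r @[r --> 0^'+] --> (0 : R) ->
  r ^+ n.+1 * f r @[r --> 0^'+] --> (0 : R).
Proof.
move=> sf cf; apply/cvgr0Pnorm_le => e e0.
have e20 : 0 < e / 2 by rewrite divr_gt0.
have [d /= d0 fd] : \forall r \near (0 : R)^'+, `|r ^+ n.+2 * f^`()%classic r| <= e / 2.
  exact: cvgr0_norm_le cf _ e20.
pose r0 := d / 2; have r00 : 0 < r0 by rewrite divr_gt0.
have bd (s : R) : 0 < s < r0 -> `|f^`()%classic s| <= e / 2 * (n.+1%:R * s^-1 ^+ n.+2).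
  move=> /andP[s0 sr]; have := fd s.
  rewrite /ball_/= sub0r normrN gtr0_norm// => /(_ _ s0).
  have -> : s < d by rewrite (lt_trans sr)// /r0 ltr_pdivrMr// ltr_pMr// ltr1n.
  move=> /(_ isT); rewrite normrM gtr0_norm ?exprn_gt0//.
  rewrite -ler_pdivlMl ?exprn_gt0// -exprVn => /le_trans; apply.
  rewrite mulrC ler_pM2l// ler_peMl// ?ler1n//.
  by rewrite exprn_ge0// invr_ge0 ltW.
(* [F b] is nonincreasing on ]0, r0] for |b| <= 1. The choices [b = 1] and [b = -1] bound f from
   both sides, in place of an integral of f'. *)
pose F b s := b * f s + e / 2 * s^-1 ^+ n.+1.
have dF (b s : R) : 0 < s ->
    is_derive s 1 (F b) (b * f^`()%classic s + e / 2 * (- n.+1%:R * s^-1 ^+ n.+2)).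
  move=> s0; apply: is_deriveDr; apply: is_deriveZr; last exact: is_deriveVX.
  exact: smooth_is_derive.
have mF (b r : R) : `|b| <= 1 -> 0 < r < r0 -> F b r0 <= F b r.
  move=> b1 /andP[rgt0 rr0]; rewrite -lerN2.
  have dNF (s : R) (s0 : 0 < s) := is_deriveN (dF b s s0).
  apply: (@pos_derive1_ge0_le (fun s => - F b s) r r0 rgt0 (ltW rr0)).
    by move=> s /dNF[].
  move=> s /andP[rs sr0]; have s0 := lt_trans rgt0 rs.
  rewrite (derive1_val (dNF s s0)).
  have := bd s; rewrite s0 sr0 => /(_ isT) bds.
  rewrite mulNr mulrN opprD opprK addrC subr_ge0.
  apply: le_trans bds; apply: le_trans (ler_norm _) _.
  by rewrite normrM ler_piMl.
have fb (r : R) : 0 < r < r0 -> `|f r| <= `|f r0| + e / 2 * r^-1 ^+ n.+1.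
  move=> rr; have := mF 1 r; rewrite normr1 lexx => /(_ isT rr).
  have := mF (-1) r; rewrite normrN1 lexx => /(_ isT rr).
  have w0 : 0 <= e / 2 * r0^-1 ^+ n.+1.
    by rewrite mulr_ge0 ?(ltW e20)// exprn_ge0// invr_ge0 ltW.
  rewrite /F !mulN1r !mul1r; have := ler_norm (f r0).
  have := ler_norm (- f r0); rewrite normrN ler_norml => ? ? ? ?.
  by apply/andP; split; lra.
(* [f r0] is a fixed number, so the power of r, whose exponent is at least 1, sends this term to
   0. *)
have c0 : r ^+ n.+1 * `|f r0| @[r --> (0 : R)^'+] --> (0 : R).
  by rewrite -[X in _ --> X](mul0r `|f r0|); apply: cvgMr_tmp; exact: cvg0X.
near=> r.
have rgt0 : 0 < r by near: r; exact: nbhs_right_gt.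
have rr0 : r < r0 by near: r; exact: nbhs_right_lt.
have h1 : `|r ^+ n.+1 * `|f r0| | <= e / 2.
  by near: r; exact: cvgr0_norm_le c0 _ e20.
rewrite normrM gtr0_norm ?exprn_gt0//.
have := fb r; rewrite rgt0 rr0 => /(_ isT).
rewrite -(ler_pM2l (exprn_gt0 n.+1 rgt0)) => /le_trans; apply.
rewrite mulrDr mulrCA -exprMn divff ?gt_eqF// expr1n mulr1.
by rewrite [leRHS](splitr e) lerD2r (le_trans (ler_norm _)).
Unshelve. all: by end_near. Qed.

(** Scale-invariant bookkeeping: each derivative is paid for with one power of r. Differentiating
    and dividing by r then both raise [c] by one. *)
Definition vanishing c k f :=
  forall i, (i <= k)%N -> r ^+ (c + i) * f^`(i)%classic r @[r --> 0^'+] --> (0 : R).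

(** The decay of the highest derivative descends to the lower ones by integrating once per order.
    The base weight [c.+1] keeps every exponent positive along the way. *)
Lemma vanishing_top c k f : smooth_on_pos f ->
  r ^+ (c.+1 + k) * f^`(k)%classic r @[r --> 0^'+] --> (0 : R) -> vanishing c.+1 k f.
Proof.
move=> sf fk i ik; rewrite -(subKn ik).
elim: (k - i)%N => [|j IH]; first by rewrite subn0.
(* The subtraction [k - j] is truncated: once j reaches k, order 0 has been attained and the claim
   no longer changes. *)
have [kj|jk] := leqP k j.
  move: IH; rewrite (eqP (_ : k - j == 0)%N)// (eqP (_ : k - j.+1 == 0)%N)//.
  by rewrite subn_eq0 leqW.
rewrite addSn; apply: cvg0_integrate; first exact: smooth_derive1n.
rewrite -derive1nS (_ : _.+2 = c.+1 + (k - j.+1).+1)%N; last by rewrite addnS addSn.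
by rewrite subnSK.
Qed.

Lemma vanishing_eqpos c k f g : eqpos f g -> vanishing c k f -> vanishing c k g.
Proof.
move=> fg vf i ik; apply: eqpos_cvg0 (vf i ik) => r r0.
by rewrite (eqpos_derive1n i fg).
Qed.

Lemma vanishing_derive1 c k f : vanishing c k.+1 f -> vanishing c.+1 k f^`().
Proof. by move=> vf i ik; rewrite addSnnS -derive1Sn; exact: vf. Qed.

Lemma vanishing_le c k j f : (j <= k)%N -> vanishing c k f -> vanishing c j f.
Proof. by move=> jk vf i ij; apply: vf; exact: leq_trans jk. Qed.

Lemma vanishingD c k f g : smooth_on_pos f -> smooth_on_pos g ->
  vanishing c k f -> vanishing c k g -> vanishing c k (fun r => f r + g r).
Proof.
move=> sf sg vf vg i ik.
apply: (@eqpos_cvg0 (fun r => r ^+ (c + i) * f^`(i)%classic r +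
    r ^+ (c + i) * g^`(i)%classic r)).
  by move=> r r0 /=; rewrite derive1nD// mulrDr.
by rewrite -[X in _ --> X]addr0; exact: cvgD (vf i ik) (vg i ik).
Qed.

Lemma vanishingZ c k a f : smooth_on_pos f ->
  vanishing c k f -> vanishing c k (fun r => a * f r).
Proof.
move=> sf vf i ik.
apply: (@eqpos_cvg0 (fun r => a * (r ^+ (c + i) * f^`(i)%classic r))).
  by move=> r r0 /=; rewrite derive1nZ// mulrCA.
by rewrite -[X in _ --> X](mulr0 a); exact: cvgMl_tmp (vf i ik).
Qed.

Lemma smooth_div_id f : smooth_on_pos f -> smooth_on_pos (fun r => f r / r).
Proof. by move=> sf; apply: smoothM sf _; exact: smoothV. Qed.

(** Writing f = r g, the Leibniz rule f^(i+1) = r g^(i+1) + (i+1) g^(i) is solved for the top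
    derivative of g, and induction on the order handles the other term. *)
Lemma vanishing_div_id c k f : smooth_on_pos f ->
  vanishing c k f -> vanishing c.+1 k (fun r => f r / r).
Proof.
move=> sf vf; have sg := smooth_div_id sf; set g := (X in vanishing _ _ X).
have fg : eqpos f (fun r => r * g r) by move=> r r0; rewrite /g mulrC divfK ?gt_eqF.
have eqn i : eqpos f^`(i) (fun r => r * g^`(i)%classic r + i%:R * g^`(i.-1)%classic r).
  by move=> r r0; rewrite (eqpos_derive1n i fg)// derive1n_idM.
elim=> [|i IH] ik.
  apply: eqpos_cvg0 (vf 0%N ik) => r r0.
  by rewrite eqn// mul0r addr0 mulrA addn0 -exprSr addn0.
apply: (@eqpos_cvg0 (fun r => r ^+ (c + i.+1) * f^`(i.+1)%classic r -
    i.+1%:R * (r ^+ (c.+1 + i) * g^`(i)%classic r))).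
  move=> r r0; rewrite (eqn i.+1 r r0) -pred_Sn !addSn !addnS !exprS; ring.
rewrite -[X in _ --> X]subr0 -[X in 0 - X](mulr0 i.+1%:R).
by apply: cvgB (vf i.+1 ik) _; exact: cvgMl_tmp (IH (ltnW ik)).
Qed.

End vanishing_at_zero.

(** * The radial Laplacian *)

Section radial_laplacian.
Context {R : realType}.
Implicit Types (f g : R -> R) (n c k N : nat) (r : R).

(* The function V = U'/r of the header. *)
Definition dslope f : R -> R := fun r => f^`()%classic r / r.

(* U'' + (N-1) U'/r; only its values at r > 0 are meaningful. *)
Definition radlap N f : R -> R := fun r => f^`()^`()%classic r + N.-1%:R * dslope f r.

Lemma smooth_dslope f : smooth_on_pos f -> smooth_on_pos (dslope f).
Proof. by move=> sf; apply: smooth_div_id; exact: smooth_derive1. Qed.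

Lemma smooth_radlap N f : smooth_on_pos f -> smooth_on_pos (radlap N f).
Proof.
move=> sf; apply: smoothD.
  by apply: smooth_derive1; exact: smooth_derive1.
by apply: smoothM; [exact: smooth_cst|exact: smooth_dslope].
Qed.

Lemma smooth_iter_radlap N m f : smooth_on_pos f -> smooth_on_pos (iter m (radlap N) f).
Proof. by move=> sf; elim: m => [|m IH]; [exact: sf|exact: smooth_radlap IH]. Qed.

Lemma derive1_dslope f : eqpos f^`() (fun r => r * dslope f r).
Proof. by move=> r r0; rewrite /dslope mulrC divfK ?gt_eqF. Qed.

Lemma derive1n_dslope n f : smooth_on_pos f ->
  eqpos f^`(n.+2) (fun r => r * (dslope f)^`(n.+1)%classic r +
    n.+1%:R * (dslope f)^`(n)%classic r).
Proof.
move=> sf r r0; rewrite derive1Sn (eqpos_derive1n _ (derive1_dslope f))//.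
by rewrite (derive1n_idM n.+1 (smooth_dslope sf)).
Qed.

Lemma radlap_dslope N f : (0 < N)%N -> smooth_on_pos f ->
  eqpos (radlap N f) (fun r => r * (dslope f)^`()%classic r + N%:R * dslope f r).
Proof.
move=> N0 sf r r0; rewrite /radlap (eqpos_derive1 (derive1_dslope f))//.
rewrite (derive1_val (is_deriveMr (is_derive_id r 1)
  (smooth_is_derive (smooth_dslope sf) r0))).
by rewrite -[in RHS](prednK N0) -natr1; ring.
Qed.

Lemma derive1n_radlap N n f : (0 < N)%N -> smooth_on_pos f ->
  eqpos (radlap N f)^`(n)
    (fun r => r * (dslope f)^`(n.+1)%classic r + (N + n)%:R * (dslope f)^`(n)%classic r).
Proof.
move=> N0 sf r r0; have sV := smooth_dslope sf; have sV' := smooth_derive1 sV.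
rewrite (eqpos_derive1n _ (radlap_dslope N0 sf))//.
rewrite (derive1nD n (smoothM smooth_id sV') (smoothM (smooth_cst (c := N%:R)) sV) r0).
rewrite (derive1n_idM n sV' r0) (derive1nZ n N%:R sV r0) -!derive1Sn natrD.
case: n => [|n]; first by rewrite mul0r !addr0.
by rewrite -pred_Sn; ring.
Qed.

(** Differentiating r V' + N V gives r V'' + (N+1) V', which is then divided by r. *)
Lemma dslope_radlap N f : (0 < N)%N -> smooth_on_pos f ->
  eqpos (dslope (radlap N f))
    (fun r => (dslope f)^`()^`()%classic r + N.+1%:R * dslope (dslope f) r).
Proof.
move=> N0 sf r r0; rewrite {1}/dslope.
rewrite (derive1n_radlap 1 N0 sf r0 : (radlap N f)^`()%classic r = _).
by rewrite mulrDl mulrC mulKf ?gt_eqF// addn1 /dslope mulrA.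
Qed.

(** Both terms V'' and V'/r cost two powers of r. The first uses up two orders of differentiability
    and the second one, so two orders fewer are kept. *)
Lemma vanishing_dslope_radlap N c k f : (0 < N)%N -> smooth_on_pos f ->
  vanishing c k.+2 (dslope f) -> vanishing c.+2 k (dslope (radlap N f)).
Proof.
move=> N0 sf vV; have sV := smooth_dslope sf; have sV' := smooth_derive1 sV.
have vV' := vanishing_derive1 vV.
apply: (vanishing_eqpos (f := fun r => (dslope f)^`()^`()%classic r +
    N.+1%:R * dslope (dslope f) r)).
  by move=> r r0; rewrite dslope_radlap.
apply: vanishingD; [exact: smooth_derive1| |exact: vanishing_derive1|].
  by apply: smoothM; [exact: smooth_cst|exact: smooth_dslope].
apply: vanishingZ; first exact: smooth_dslope.
by apply: vanishing_div_id => //; exact: vanishing_le vV'.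
Qed.

Lemma vanishing_dslope_iter N c k m f : (0 < N)%N -> smooth_on_pos f ->
  vanishing c (k + m.*2) (dslope f) ->
  vanishing (c + m.*2) k (dslope (iter m (radlap N) f)).
Proof.
move=> N0 sf; elim: m k => [|m IH] k; first by rewrite !addn0.
rewrite doubleS !addnS -!addSn => /IH vV /=.
rewrite addSn; apply: vanishing_dslope_radlap; [exact: N0| |exact: vV].
exact: smooth_iter_radlap.
Qed.

End radial_laplacian.

(** * The one-dimensional inequality *)

Section integrals_on_pos.
Context {R : realType}.
Implicit Types (f g F : R -> R) (n c k N : nat) (r x y : R).
Local Notation mu := (@lebesgue_measure R).

Lemma smooth_measurable f (A : set R) : smooth_on_pos f -> measurable A ->
  A `<=` `]0, +oo[ -> measurable_fun A f.
Proof.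
move=> sf mA A0; apply: (measurable_funS _ A0); first exact: measurable_itv.
apply: open_continuous_measurable_fun; first exact: interval_open.
by move=> r; rewrite inE/= in_itv/= andbT => r0; exact: smooth_continuous.
Qed.

Lemma smooth_within f x y : smooth_on_pos f -> 0 < x ->
  {within `[x, y], continuous f}.
Proof.
move=> sf x0; apply: derivable_within_continuous => s; rewrite in_itv/= => /andP[xs _].
by apply: smooth_derivable => //; exact: lt_le_trans xs.
Qed.

Lemma smooth_integrable f x y : smooth_on_pos f -> 0 < x ->
  mu.-integrable `[x, y] (EFin \o f).
Proof.
move=> sf x0; apply: continuous_compact_integrable; first exact: segment_compact.
exact: smooth_within.
Qed.

Lemma smooth_FTC2 f x y : smooth_on_pos f -> 0 < x -> x < y ->
  (\int[mu]_(r in `[x, y]) (f^`()%classic r)%:E = (f y)%:E - (f x)%:E)%E.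
Proof.
move=> sf x0 xy; apply: continuous_FTC2 => //.
  exact: smooth_within (smooth_derive1 sf) x0.
split.
- move=> s; rewrite in_itv/= => /andP[xs _].
  by apply: smooth_derivable => //; exact: lt_trans xs.
- by apply: cvg_at_right_filter; exact: smooth_continuous.
- by apply: cvg_at_left_filter; apply: smooth_continuous => //; exact: lt_trans xy.
Qed.

(** Turns a pointwise inequality with an exact derivative into one between integrals with boundary
    terms. Both integral estimates below consist of such an inequality for a suitable [F]. *)
Lemma smooth_FTC2_le F f g x y : smooth_on_pos F -> smooth_on_pos f ->
  smooth_on_pos g -> 0 < x -> x < y ->
  (forall r, 0 < r -> F^`()%classic r + f r <= g r) ->
  ((F y)%:E - (F x)%:E + \int[mu]_(r in `[x, y]) (f r)%:E <=
   \int[mu]_(r in `[x, y]) (g r)%:E)%E.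
Proof.
move=> sF sf sg x0 xy Ffg; rewrite -smooth_FTC2//.
have sF' := smooth_derive1 sF.
rewrite -integralD//=; [|exact: smooth_integrable|exact: smooth_integrable].
apply: le_integral => //=; [|exact: smooth_integrable|].
  exact: smooth_integrable (smoothD sF' sf) x0.
move=> r; rewrite inE/= in_itv/= => /andP[xr _].
by rewrite -EFinD lee_fin Ffg// (lt_le_trans x0 xr).
Qed.

Lemma EFin_smooth_measurable f (A : set R) : smooth_on_pos f -> measurable A ->
  A `<=` `]0, +oo[ -> measurable_fun A (EFin \o f).
Proof. by move=> sf mA A0; apply/measurable_EFinP; exact: smooth_measurable. Qed.

(** Compact intervals inside the open half-line. The right end is [k.+2] so that the interval is
    nondegenerate already for [k = 0]. *)
Definition exhaust k : set (measurableTypeR R) := `[k.+1%:R^-1, k.+2%:R].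

Lemma exhaust_sub k : exhaust k `<=` `]0, +oo[.
Proof.
move=> r; rewrite /exhaust/= !in_itv/= andbT => /andP[+ _].
by apply: lt_le_trans; rewrite invr_gt0 ltr0n.
Qed.

Lemma exhaust_nondecreasing : nondecreasing_seq exhaust.
Proof.
apply/nondecreasing_seqP => k; rewrite subsetEset; apply: subset_itv; rewrite bnd_simp.
  by rewrite lef_pV2 ?posrE ?ltr0n// ler_nat.
by rewrite ler_nat.
Qed.

Lemma near_natSinv x : 0 < x -> exists k, k.+1%:R^-1 < x.
Proof.
move=> x0; have [k _ kx] := near_infty_natSinv_lt (PosNum x0).
by exists k; apply: (kx k) => /=.
Qed.

Lemma bigcup_exhaust : \bigcup_k exhaust k = `]0, +oo[.
Proof.
apply/seteqP; split=> [r [k _]|r]; first exact: exhaust_sub.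
rewrite /= in_itv/= andbT => r0.
have [k kr] := near_natSinv r0; have [j jr] : exists j, r < j.+1%:R.
  exists (Num.truncn r); exact: truncnS_gt.
exists (maxn k j) => //; rewrite /exhaust/= in_itv/=; apply/andP; split.
  apply: le_trans (ltW kr); rewrite lef_pV2 ?posrE ?ltr0n// ler_nat ltnS.
  exact: leq_maxl.
by rewrite (le_trans (ltW jr))// ler_nat ltnS (leq_trans (leq_maxr k j)).
Qed.

(** Monotone convergence for a nonnegative integrand, so the limit is allowed to be infinite. *)
Lemma cvg_exhaust f : smooth_on_pos f -> (forall r, 0 < r -> 0 <= f r) ->
  (\int[mu]_(r in exhaust k) (f r)%:E @[k --> \oo] -->
   \int[mu]_(r in `]0%R, +oo[) (f r)%:E)%E.
Proof.
move=> sf f0; rewrite -bigcup_exhaust; apply: ge0_nondecreasing_set_cvg_integral.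
- exact: exhaust_nondecreasing.
- by move=> i; exact: measurable_itv.
- move=> i; apply: EFin_smooth_measurable; [exact: sf|exact: measurable_itv|].
  exact: exhaust_sub.
- by move=> i r /exhaust_sub/=; rewrite in_itv/= andbT lee_fin; exact: f0.
Qed.

Lemma cvg_right_ray f : smooth_on_pos f -> (forall r, 0 < r -> 0 <= f r) ->
  (\int[mu]_(r in `](k.+1%:R^-1)%R, +oo[) (f r)%:E @[k --> \oo] -->
   \int[mu]_(r in `]0%R, +oo[) (f r)%:E)%E.
Proof.
move=> sf f0; pose F k : set (measurableTypeR R) := `]k.+1%:R^-1, +oo[.
have -> : `]0%R, +oo[%classic = \bigcup_k F k.
  apply/seteqP; split=> r /=; rewrite /F ?in_itv/= ?andbT.
    by move=> /near_natSinv[k kr]; exists k => //=; rewrite in_itv/= kr.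
  by move=> [k _ /=]; rewrite in_itv/= andbT; apply: le_lt_trans.
apply: (@ge0_nondecreasing_set_cvg_integral _ _ _ F (EFin \o f) mu).
- apply/nondecreasing_seqP => k; rewrite subsetEset; apply: subset_itv; rewrite ?bnd_simp//.
  by rewrite lef_pV2 ?posrE ?ltr0n// ler_nat.
- by move=> i; exact: measurable_itv.
- move=> i; apply: EFin_smooth_measurable; [exact: sf|exact: measurable_itv|] => r.
  by rewrite /F/= !in_itv/= !andbT; apply: le_lt_trans.
- move=> i r; rewrite /F/= in_itv/= andbT lee_fin => ri; apply: f0.
  by apply: le_lt_trans ri.
Qed.

Lemma split_pos f x : 0 < x -> smooth_on_pos f -> (forall r, 0 < r -> 0 <= f r) ->
  (\int[mu]_(r in `]0%R, +oo[) (f r)%:E =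
   \int[mu]_(r in `]0%R, x]) (f r)%:E + \int[mu]_(r in `]x, +oo[) (f r)%:E)%E.
Proof.
move=> x0 sf f0; have U : `]0, x] `|` `]x, +oo[ = `]0, +oo[%classic.
  by rewrite -itv_bndbnd_setU// bnd_simp// ltW.
rewrite -U ge0_integral_setU//= ?U.
- by apply: EFin_smooth_measurable.
- move=> r; rewrite !in_itv/= andbT lee_fin => -[/andP[r0 _]|/(lt_trans x0) r0];
  exact: f0.
- apply/disj_setPS => r [] /=; rewrite !in_itv/= andbT => /andP[_ rx].
  by move/(le_lt_trans rx); rewrite ltxx.
Qed.

End integrals_on_pos.

(** * First-order comparison of weighted integrals on the half-line *)

Section one_dimensional_inequality.
Context {R : realType}.
Local Notation mu := (@lebesgue_measure R).

Lemma smooth_sqr (f : R -> R) : smooth_on_pos f -> smooth_on_pos (fun r => f r ^+ 2).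
Proof. by move=> sf; under eq_fun do rewrite expr2; exact: smoothM. Qed.

Lemma integral_mono_itv (f : R -> R) (A B : set (measurableTypeR R)) :
  smooth_on_pos f -> (forall r, 0 < r -> 0 <= f r) ->
  measurable A -> measurable B -> A `<=` B -> B `<=` `]0, +oo[ ->
  (\int[mu]_(r in A) (f r)%:E <= \int[mu]_(r in B) (f r)%:E)%E.
Proof.
move=> sf f0 mA mB AB B0; apply: ge0_subset_integral => //.
  exact: EFin_smooth_measurable.
by move=> r /B0/=; rewrite in_itv/= andbT lee_fin; exact: f0.
Qed.

Variables (N n : nat) (Z : R -> R).
Hypotheses (N0 : (0 < N)%N) (sZ : smooth_on_pos Z).

(** When [Z] is V^(n), [G n.+1] is U^(n+2) and [G (N + n)] is (L U)^(n); [g] is the corresponding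
    weighted square. *)
Let G (k : nat) (r : R) := r * Z^`()%classic r + k%:R * Z r.
Let g (k : nat) (r : R) := G k r ^+ 2 * r ^+ (N - 1).

Let sG k : smooth_on_pos (G k).
Proof.
apply: smoothD; first exact: smoothM smooth_id (smooth_derive1 sZ).
exact: smoothM (smooth_cst (c := k%:R)) sZ.
Qed.

Let sg k : smooth_on_pos (g k).
Proof. exact: smoothM (smooth_sqr (@sG k)) (smoothX (n := N - 1)). Qed.

Let g0 k r : 0 < r -> 0 <= g k r.
Proof. by move=> r0; rewrite mulr_ge0 ?sqr_ge0// exprn_ge0// ltW. Qed.

Let N1 : N = (N - 1).+1.
Proof. by rewrite subn1 prednK. Qed.

Hypothesis Z0 : r ^+ N * Z r @[r --> 0^'+] --> (0 : R).

(** The function r^(N+n) Z tends to 0 at 0 and has derivative r^(N+n-1) [G (N + n)], so its value at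
    x is controlled by the integral over ]0, x]. An infinite integral leaves nothing to prove. *)
Lemma boundary_term_le x : 0 < x ->
  ((x ^+ N * Z x ^+ 2)%:E <= \int[mu]_(r in `]0%R, x]) (g (N + n) r)%:E)%E.
Proof.
move=> x0; set I := (X in (_ <= X)%E).
have [->|Ioo] := eqVneq I +oo%E; first exact: leey.
have I0 : (0 <= I)%E.
  by apply: integral_ge0 => r /=; rewrite in_itv/= lee_fin => /andP[r0 _]; exact: g0.
have If : I = (fine I)%:E by rewrite fineK// ge0_fin_numE// ltey.
pose h r := r ^+ (N + n) * Z r.
(* F' <= g for every k, by completing the square; the optimal k, used at the
   end, gives the Cauchy-Schwarz bound for the integral of h'. *)
pose F k r := 2 * k * h r + - k ^+ 2 * r ^+ (N + n + n).
have sF k : smooth_on_pos (F k).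
  have s1 := smoothM (smooth_cst (c := 2 * k)) (smoothM (smoothX (n := N + n)) sZ).
  have s2 := smoothM (smooth_cst (c := - k ^+ 2)) (smoothX (n := N + n + n)).
  exact: smoothD s1 s2.
have F0 k : F k r @[r --> 0^'+] --> (0 : R).
  rewrite -[X in _ --> X]addr0; apply: cvgD.
    rewrite -[X in _ --> X](mulr0 (2 * k)); apply: cvgMl_tmp.
    apply: (@eqpos_cvg0 _ (fun r => r ^+ n * (r ^+ N * Z r))).
      by move=> r _; rewrite /h exprD; ring.
    (* For [n = 0] the factor [r ^+ n] is 1 and the limit is exactly [Z0]; otherwise this factor
       tends to 0 as well. *)
    have [->|n0] := posnP n.
      by under eq_fun do rewrite expr0 mul1r.
    rewrite -[X in _ --> X](mul0r 0); apply: cvgM => //.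
    by rewrite -(prednK n0); exact: cvg0X.
  rewrite -[X in _ --> X](mulr0 (- k ^+ 2)); apply: cvgMl_tmp.
  by rewrite N1 !addSn; exact: cvg0X.
have Fx k : F k x <= fine I.
  apply/ler_addgt0Pr => e e0.
  have Fe := cvgr0_norm_le _ (F0 k) _ e0.
  (* The lower end y is taken so close to 0 that [F k y] is at most e; the estimate is then
     integrated over [y, x] and e is arbitrary. *)
  near (0 : R)^'+ => y.
  have y0 : 0 < y by near: y; exact: nbhs_right_gt.
  have yx : y < x by near: y; exact: nbhs_right_lt.
  have Fy : F k y <= e by apply: le_trans (ler_norm _) _; near: y; exact: Fe.
  rewrite -lerBlDr; apply: (@le_trans _ _ (F k x - F k y)); first by rewrite lerD2l lerN2.
  rewrite -lee_fin -If EFinB.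
  apply: (@le_trans _ _ (\int[mu]_(r in `[y, x]) (g (N + n) r)%:E)%E); last first.
    apply: integral_mono_itv;
      [exact: sg|exact: g0|exact: measurable_itv|exact: measurable_itv| |].
      by apply: subset_itv; rewrite bnd_simp.
    by move=> r /=; rewrite !in_itv/= andbT => /andP[].
  have := @smooth_FTC2_le _ (F k) (fun=> 0) (g (N + n)) y x.
  rewrite integral0 adde0; apply;
    [exact: sF|exact: smooth_cst|exact: sg|exact: y0|exact: yx|] => r r0.
  have dh := is_deriveMr (is_deriveXr (N + n) r) (smooth_is_derive sZ r0).
  rewrite (derive1_val (is_deriveDr (is_deriveZr (2 * k) dh)
    (is_deriveZr (- k ^+ 2) (is_deriveXr (N + n + n) r)))) addr0.
  rewrite -subr_ge0 /g /G [X in 0 <= X](_ : _ = r ^+ (N - 1) *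
     ((r * Z^`()%classic r + (N + n)%:R * Z r - k * r ^+ n) ^+ 2
       + (N + n + n - 1)%:R * k ^+ 2 * (r ^+ n) ^+ 2)); last first.
    rewrite N1; set M := (N - 1)%N; rewrite !addSn subn1 /= subn1 /=.
    rewrite -!natr1 !exprS !exprD !natrD; ring.
  apply: mulr_ge0; first by rewrite exprn_ge0// ltW.
  by apply: addr_ge0; rewrite ?sqr_ge0// mulr_ge0 ?sqr_ge0// mulr_ge0 ?sqr_ge0.
(* This k maximizes [F k x]; the maximum h(x)^2 / x^(N+2n) equals x^N Z(x)^2. *)
rewrite If lee_fin; apply: le_trans (Fx (h x / x ^+ (N + n + n))).
rewrite le_eqVlt; apply/orP; left; apply/eqP; rewrite /F /h !exprD.
by field; rewrite !expf_neq0 ?gt_eqF.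
Unshelve. all: by end_near. Qed.

Lemma lt_natSinv_natSS k : k.+1%:R^-1 < k.+2%:R :> R.
Proof. by rewrite (@le_lt_trans _ _ 1)// ?invf_le1 ?ltr1n ?ltr0n// ler1n. Qed.

(** On [x, y] the derivative of F = (N-1) r^N Z^2 plus [g n.+1] is at most [g (N + n)]. The boundary
    term at x is absorbed by N-1 times the integral over ]0, x], which disappears in the limit if
    the right side is finite. *)
Lemma integral_first_order_le :
  (\int[mu]_(r in `]0%R, +oo[) (g n.+1 r)%:E <=
   \int[mu]_(r in `]0%R, +oo[) (g (N + n) r)%:E)%E.
Proof.
set E := (X in (_ <= X)%E).
have [->|Eoo] := eqVneq E +oo%E; first exact: leey.
have posint (f : R -> R) (A : set (measurableTypeR R)) : A `<=` `]0, +oo[ ->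
    (forall r, 0 < r -> 0 <= f r) -> (0 <= \int[mu]_(r in A) (f r)%:E)%E.
  move=> A0 f0; apply: integral_ge0 => r /A0 /=.
  by rewrite in_itv/= andbT lee_fin; exact: f0.
have E0 : (0 <= E)%E by apply: posint => // r; exact: g0.
have Ef : E \is a fin_num by rewrite ge0_fin_numE// ltey.
have c0 : 0 <= N.-1%:R :> R by [].
pose J k := (\int[mu]_(r in `](k.+1%:R^-1)%R, +oo[) (g (N + n) r)%:E)%E.
have cJ : (N.-1%:R%:E * J k @[k --> \oo] --> N.-1%:R%:E * E)%E.
  by apply: cvgeZl => //; apply: cvg_right_ray; [exact: sg|exact: g0].
have cH := cvg_exhaust (@sg n.+1) (@g0 n.+1).
(* J is added on both sides so that the boundary term, bounded by the integral
   over ]0, x], completes J to E. *)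
have step k : (\int[mu]_(r in exhaust k) (g n.+1 r)%:E + N.-1%:R%:E * J k <=
    E + N.-1%:R%:E * E)%E.
  set x : R := k.+1%:R^-1; set y : R := k.+2%:R.
  have x0 : 0 < x by rewrite invr_gt0 ltr0n.
  have y0 : 0 < y by rewrite ltr0n.
  have xy : x < y by exact: lt_natSinv_natSS.
  pose I := (\int[mu]_(r in `]0%R, x]) (g (N + n) r)%:E)%E.
  have sp : E = (I + J k)%E := split_pos x0 (@sg _) (@g0 _).
  have I0 : (0 <= I)%E.
    by apply: posint => [r /=|r]; [rewrite !in_itv/= andbT => /andP[]|exact: g0].
  have J0 : (0 <= J k)%E.
    apply: posint => [r /=|r]; last exact: g0.
    by rewrite !in_itv/= !andbT; exact: lt_trans.
  rewrite {2}sp (ge0_muleDr _ I0 J0).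
  rewrite addeA leeD2r//.
  pose F r := N.-1%:R * (r ^+ N * Z r ^+ 2).
  have sF : smooth_on_pos F.
    exact: smoothM (smooth_cst (c := N.-1%:R)) (smoothM (smoothX (n := N)) (smooth_sqr sZ)).
  have FG : (\int[mu]_(r in exhaust k) (g n.+1 r)%:E <=
      (F x)%:E + \int[mu]_(r in exhaust k) (g (N + n) r)%:E)%E.
    have := @smooth_FTC2_le _ F (g n.+1) (g (N + n)) x y sF (@sg _) (@sg _) x0 xy.
    have Fy : 0 <= F y by rewrite mulr_ge0// mulr_ge0 ?sqr_ge0// exprn_ge0// ltW.
    move=> FG; rewrite -leeBlDl//; apply: le_trans (FG _).
      rewrite -EFinB addeC leeD2r// lee_fin lerDr//.
    move=> r r0.
    have dZ := smooth_is_derive sZ r0.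
    have dZ2 := is_deriveMr dZ dZ.
    have := is_deriveZr N.-1%:R (is_deriveMr (is_deriveXr N r) dZ2).
    under [X in is_derive _ _ X _]eq_fun do rewrite -expr2.
    move=> /derive1_val; rewrite -/F => ->.
    rewrite -subr_ge0 /g /G [X in 0 <= X](_ : _ = N.-1%:R * n.*2.+1%:R *
      r ^+ (N - 1) * Z r ^+ 2); last first.
      rewrite N1; set M := (N - 1)%N; rewrite !addSn subn1 /=.
      by rewrite -addnn -!natr1 !exprS !natrD; ring.
    by rewrite mulr_ge0 ?sqr_ge0// mulr_ge0 ?exprn_ge0 ?(ltW r0).
  apply: le_trans FG _; rewrite [leRHS]addeC; apply: leeD.
    by rewrite EFinM lee_wpmul2l// boundary_term_le.
  by apply: integral_mono_itv; [exact: sg|exact: g0|exact: measurable_itv|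
    exact: measurable_itv|exact: exhaust_sub|by []].
(* Passing to the limit in k turns [J k] into [E]; the surplus (N-1) E then cancels because [E] is
   finite. *)
have : (\int[mu]_(r in `]0%R, +oo[) (g n.+1 r)%:E + N.-1%:R%:E * E <=
    E + N.-1%:R%:E * E)%E.
  have cs : (\int[mu]_(r in exhaust k) (g n.+1 r)%:E + N.-1%:R%:E * J k
      @[k --> \oo] --> \int[mu]_(r in `]0%R, +oo[) (g n.+1 r)%:E + N.-1%:R%:E * E)%E.
    apply: cvgeD => //; rewrite fin_num_adde_defl// fin_numM//.
  rewrite -(cvg_lim _ cs)//; apply: lime_le; first by apply/cvg_ex; eexists; exact: cs.
  exact: nearW.
by rewrite leeD2rE// fin_numM.
Qed.

End one_dimensional_inequality.

(** * Iteration of the radial Laplacian *)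

Section radial_inequality.
Context {R : realType}.
Implicit Types (f : R -> R) (N m n j k : nat).
Local Notation mu := (@lebesgue_measure R).

Lemma eq_integral_pos (f g : R -> R) : eqpos f g ->
  (\int[mu]_(r in `]0%R, +oo[) (f r)%:E = \int[mu]_(r in `]0%R, +oo[) (g r)%:E)%E.
Proof.
by move=> fg; apply: eq_integral => r; rewrite inE/= in_itv/= andbT => r0; rewrite fg.
Qed.

Lemma radial_step N n f : (0 < N)%N -> smooth_on_pos f ->
  r ^+ N * (dslope f)^`(n)%classic r @[r --> 0^'+] --> (0 : R) ->
  (\int[mu]_(r in `]0%R, +oo[) (f^`(n.+2)%classic r ^+ 2 * r ^+ (N - 1))%:E <=
   \int[mu]_(r in `]0%R, +oo[) ((radlap N f)^`(n)%classic r ^+ 2 * r ^+ (N - 1))%:E)%E.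
Proof.
move=> N0 sf Z0; have sZ : smooth_on_pos (dslope f)^`(n).
  by apply: smooth_derive1n; exact: smooth_dslope.
have := integral_first_order_le n N0 sZ Z0.
rewrite -derive1nS; congr (_ <= _)%E; apply: eq_integral_pos => r r0.
  by rewrite derive1n_dslope.
by rewrite derive1n_radlap.
Qed.

(** Chain of m comparisons: the i-th one passes from the derivative of order K - 2i of L^i f to that
    of order K - 2i - 2 of L^(i+1) f, where K = 2m + j. *)
Lemma iter_radlap_integral_le N m j f : (0 < m)%N -> (m.*2 + j <= N.+1)%N ->
  (0 < N)%N -> smooth_on_pos f ->
  r ^+ N * (dslope f)^`(m.*2 + j - 2)%classic r @[r --> 0^'+] --> (0 : R) ->
  (\int[mu]_(r in `]0%R, +oo[) (f^`(m.*2 + j)%classic r ^+ 2 * r ^+ (N - 1))%:E <=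
   \int[mu]_(r in `]0%R, +oo[)
      ((iter m (radlap N) f)^`(j)%classic r ^+ 2 * r ^+ (N - 1))%:E)%E.
Proof.
move=> m0 KN N0 sf; set K := (m.*2 + j)%N in KN *.
have K2 : (2 <= K)%N by rewrite /K; lia.
(* The condition K <= N+1 enters here: it makes N equal to c+1 plus K-2, so the base weight left for
   order 0 is at least 1. *)
pose c := (N - (K - 1))%N.
have Nc : N = (c.+1 + (K - 2))%N by rewrite /c; lia.
rewrite {1}Nc => /(vanishing_top (smooth_dslope sf)) vV.
suff H i : (i <= m)%N ->
  (\int[mu]_(r in `]0%R, +oo[) (f^`(K)%classic r ^+ 2 * r ^+ (N - 1))%:E <=
   \int[mu]_(r in `]0%R, +oo[)
      ((iter i (radlap N) f)^`(K - i.*2)%classic r ^+ 2 * r ^+ (N - 1))%:E)%E.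
  by have := H m (leqnn m); rewrite /K addKn.
elim: i => [|i IH] im; first by rewrite subn0.
apply: le_trans (IH (ltnW im)) _.
have -> : (K - i.*2 = (K - i.+1.*2).+2)%N by rewrite /K; lia.
have si : smooth_on_pos (iter i (radlap N) f) by exact: smooth_iter_radlap.
apply: (radial_step N0 si).
set n := (K - i.+1.*2)%N.
have vi : vanishing (c.+1 + i.*2) n (dslope (iter i (radlap N) f)).
  apply: vanishing_dslope_iter => //.
  by move: vV; congr vanishing; rewrite /n /K; lia.
(* Each Laplacian adds two to the base weight and removes two orders, so the weight at the top order
   is always exactly N. *)
have cN : (c.+1 + i.*2 + n = N)%N by rewrite /n /c /K; lia.
by have := vi n (leqnn n); rewrite cN.
Qed.

End radial_inequality.

(** * Laplacian of radial functions *)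

Section radial_functions.
Context {R : realType} {N : nat}.
Implicit Types (F : 'rV[R]_N -> R) (x y : 'rV[R]_N) (W : R -> R) (i : 'I_N) (h : R).
Local Notation e_ i := (delta_mx ord0 i : 'rV[R]_N).

Lemma enorm_sqr x : enorm x ^+ 2 = \sum_i x ord0 i ^+ 2.
Proof. by rewrite /enorm sqr_sqrtr// sumr_ge0// => i _; exact: sqr_ge0. Qed.

(** Along a coordinate line the squared norm is a quadratic polynomial in h, which reduces partial
    derivatives to one-variable calculus. *)
Lemma enorm_line x i h :
  enorm (h *: e_ i + x) = Num.sqrt (h ^+ 2 + h * (2 * x ord0 i) + enorm x ^+ 2).
Proof.
rewrite enorm_sqr /enorm; congr Num.sqrt.
rewrite (bigD1 i)//= [in RHS](bigD1 i)//= !mxE !eqxx addrA; congr (_ + _).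
  by rewrite /= mulr1; ring.
apply: eq_bigr => j /negbTE ji; by rewrite !mxE ji andbF mulr0 add0r.
Qed.

Lemma is_derive_enorm_line x i : 0 < enorm x ->
  is_derive (0 : R) 1 (fun h => enorm (h *: e_ i + x)) (x ord0 i / enorm x).
Proof.
move=> x0; under eq_fun do rewrite enorm_line.
pose q h := h ^+ 2 + h * (2 * x ord0 i) + enorm x ^+ 2.
have dq : is_derive (0 : R) 1 q (2 * x ord0 i).
  have := is_deriveDr (is_deriveDr (is_deriveXr 2 (0 : R))
    (is_deriveMr (is_derive_id (0 : R) 1) (is_derive_cst (2 * x ord0 i) (0 : R) 1)))
    (is_derive_cst (enorm x ^+ 2) (0 : R) 1).
  by congr is_derive; rewrite /= expr1; ring.
have q0 : q 0 = enorm x ^+ 2 by rewrite /q; ring.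
have := is_derive1_comp (is_derive1_sqrt (x := q 0) _) dq.
rewrite q0 sqrtr_sqr gtr0_norm// exprn_gt0// => /(_ isT).
by congr is_derive; field; rewrite gt_eqF.
Qed.

Lemma near_enorm_line x i : 0 < enorm x ->
  \forall h \near (0 : R), 0 < enorm (h *: e_ i + x).
Proof.
move=> x0; have [/derivable1_diffP/differentiable_continuous + _] :=
  is_derive_enorm_line i x0.
by move=> /cvgr_gt; apply; rewrite scale0r add0r.
Qed.

Lemma partial_line F x i : partial i F x = (fun h => F (h *: e_ i + x))^`()%classic 0.
Proof.
rewrite /partial /derive /derive1.
rewrite (_ : (fun h : R => h^-1 *: ((F \o shift x) (h *: e_ i) - F x)) =
  (fun h => h^-1 *: (F ((h + 0) *: e_ i + x) - F (0 *: e_ i + x))))//.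
by apply/funext => h /=; rewrite addr0 scale0r add0r.
Qed.

(** A short segment through a point off the origin stays off the origin. The values of iterated
    Laplacians at the origin, about which nothing is known, therefore never enter. *)
Lemma partial_congr F G x i : (forall y, 0 < enorm y -> F y = G y) ->
  0 < enorm x -> partial i F x = partial i G x.
Proof.
move=> FG x0; rewrite !partial_line !derive1E; apply: near_eq_derive.
by near=> h; apply: FG; near: h; exact: near_enorm_line.
Unshelve. all: by end_near. Qed.

Lemma is_derive_radial_line W x i : 0 < enorm x -> derivable W (enorm x) 1 ->
  is_derive (0 : R) 1 (fun h => radial W (h *: e_ i + x))
    (W^`()%classic (enorm x) * (x ord0 i / enorm x)).
Proof.
move=> x0 dW; have := is_derive1_comp (f := W) _ (is_derive_enorm_line i x0).
by apply; rewrite scale0r add0r; exact: is_derive_pos.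
Qed.

Lemma partial_radial W x i : 0 < enorm x -> derivable W (enorm x) 1 ->
  partial i (radial W) x = dslope W (enorm x) * x ord0 i.
Proof.
move=> x0 dW; rewrite partial_line (derive1_val (is_derive_radial_line i x0 dW)).
by rewrite /dslope; ring.
Qed.

Lemma partial_radial_mul W x i : 0 < enorm x -> derivable W (enorm x) 1 ->
  partial i (fun y => radial W y * y ord0 i) x =
  W^`()%classic (enorm x) * x ord0 i ^+ 2 / enorm x + W (enorm x).
Proof.
move=> x0 dW; rewrite partial_line.
have dx : is_derive (0 : R) 1 (fun h => h + x ord0 i) (1 + 0).
  exact: is_deriveDr (is_derive_id (0 : R) 1) (is_derive_cst (x ord0 i) (0 : R) 1).
have -> : (fun h => radial W (h *: e_ i + x) * (h *: e_ i + x) ord0 i) =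
    (fun h => radial W (h *: e_ i + x) * (h + x ord0 i)).
  by apply/funext => h; rewrite !mxE !eqxx mulr1.
rewrite (derive1_val (is_deriveMr (is_derive_radial_line i x0 dW) dx)).
by rewrite /radial scale0r !add0r; ring.
Qed.

Hypothesis N0 : (0 < N)%N.

(** The partial derivatives are V x_i, and those of V x_i are V' x_i^2 / r + V; their sum over i is
    r V' + N V. Asking that [F] be radial only off the origin makes the statement iterable. *)
Lemma laplacian_radial F W x : smooth_on_pos W ->
  (forall y, 0 < enorm y -> F y = radial W y) -> 0 < enorm x ->
  laplacian F x = radial (radlap N W) x.
Proof.
move=> sW FW x0; have sV := smooth_dslope sW.
rewrite /laplacian /radial radlap_dslope//.
transitivity (\sum_(i < N) ((dslope W)^`()%classic (enorm x) * x ord0 i ^+ 2 / enorm x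
   + dslope W (enorm x))).
  apply: eq_bigr => i _; rewrite -partial_radial_mul//; last exact: smooth_derivable.
  apply: partial_congr => // y y0; rewrite (partial_congr i FW y0) partial_radial//.
  exact: smooth_derivable.
rewrite big_split/= sumr_const card_ord -mulr_suml -mulr_sumr -enorm_sqr.
by rewrite -[in LHS]mulr_natl; field; rewrite gt_eqF.
Qed.

Lemma iter_laplacian_radial m U x : smooth_on_pos U -> 0 < enorm x ->
  iter m (@laplacian R N) (radial U) x = radial (iter m (radlap N) U) x.
Proof.
move=> sU; elim: m x => [//|m IH] x x0; apply: laplacian_radial => //.
exact: smooth_iter_radlap.
Qed.

Lemma enorm_grad_radial F W x : smooth_on_pos W ->
  (forall y, 0 < enorm y -> F y = radial W y) -> 0 < enorm x ->
  enorm (grad F x) ^+ 2 = W^`()%classic (enorm x) ^+ 2.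
Proof.
move=> sW FW x0; rewrite enorm_sqr.
under eq_bigr => i _.
  rewrite mxE (partial_congr i FW x0) partial_radial//; last exact: smooth_derivable.
  rewrite exprMn; over.
by rewrite -mulr_sumr -enorm_sqr /dslope expr_div_n divfK// expf_neq0// gt_eqF.
Qed.

End radial_functions.

(** * Polar coordinates *)

Section scaling.
Context {R : realType}.
Local Notation mu := (@lebesgue_measure R).
Local Notation M := (measurableTypeR R).
Local Notation Leb := (lebesgue_tuple R).

(** Names the canonical measure structure on a pushforward, so that it can be scaled, restricted and
    integrated against as a term. *)
Definition pushforward_measure d1 d2 (X : measurableType d1) (Y : measurableType d2)
    (phi : X -> Y) (mphi : measurable_fun setT phi)
    (nu : {measure set X -> \bar R}) : {measure set Y -> \bar R} :=
  measure_function_pushforward__canonical__measure_function_Measure nu mphi.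

Lemma measurable_mulr (r : R) : measurable_fun [set: M] ( *%R r : M -> M).
Proof. by apply: measurable_funM; [exact: measurable_cst|exact: measurable_id]. Qed.

(** The right side is a measure in A that gives half-open intervals their length, so uniqueness of
    Lebesgue measure applies. *)
Lemma lebesgue_measure_mulr (r : R) (A : set M) : 0 < r -> measurable A ->
  (mu A = r%:E * mu ( *%R r @^-1` A))%E.
Proof.
move=> r0 mA; pose k : {nonneg R} := NngNum (ltW r0).
pose nu : {measure set M -> \bar R} := mscale k (pushforward_measure (measurable_mulr r) mu).
apply: (@lebesgue_measure_unique R nu) mA => _ [[a b] _ <-]/=.
rewrite /nu /mscale/= /pushforward.
have -> : *%R r @^-1` `]a, b] = `]a / r, b / r]%classic.
  apply/seteqP; split=> s /=; rewrite !in_itv/=.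
    by rewrite ltr_pdivrMr// ler_pdivlMr// ![_ * r]mulrC.
  by rewrite ltr_pdivrMr// ler_pdivlMr// ![_ * r]mulrC.
rewrite !lebesgue_measure_itv/= !lte_fin ltr_pM2r ?invr_gt0//.
case: ifP => _; last by rewrite mule0.
by rewrite -!EFinB -EFinM -mulrBl mulrC divfK ?gt_eqF.
Qed.

Lemma ge0_integral_mulr (r : R) (f : M -> \bar R) : 0 < r ->
  measurable_fun setT f -> (forall x, 0 <= f x)%E ->
  (\int[mu]_x f x = r%:E * \int[mu]_x f (r * x)%R)%E.
Proof.
move=> r0 mf f0; pose k : {nonneg R} := NngNum (ltW r0).
pose p := pushforward_measure (measurable_mulr r) mu.
transitivity (\int[mscale k p]_x f x)%E.
  by apply: eq_measure_integral => A mA _; exact: lebesgue_measure_mulr.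
rewrite ge0_integral_mscale//; congr (_ * _)%E.
by rewrite (ge0_integral_pushforward (measurable_mulr r)).
Qed.

Definition scale_tuple (r : R) (n : nat) (t : n.-tuple M) : n.-tuple M :=
  [tuple of map ( *%R r) t].

Lemma tnth_scale r n (t : n.-tuple M) i : tnth (scale_tuple r t) i = r * tnth t i.
Proof. by rewrite tnth_map. Qed.

Lemma measurable_scale_tuple r n : measurable_fun setT (@scale_tuple r n).
Proof.
apply/measurable_fun_tnthP => i.
rewrite (_ : _ \o _ = *%R r \o (fun t => tnth t i)).
  by apply: measurableT_comp; [exact: measurable_mulr|exact: measurable_tnth].
by apply/funext => t /=; rewrite tnth_scale.
Qed.

Lemma scale_tcons r n (x : M) (t : n.-tuple M) :
  scale_tuple r (tcons (x, t)) = tcons (r * x, scale_tuple r t).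
Proof. by apply: val_inj. Qed.

Lemma measurableT_preimage d1 d2 (X : measurableType d1) (Y : measurableType d2)
  (phi : X -> Y) (A : set Y) : measurable_fun setT phi -> measurable A ->
  measurable (phi @^-1` A).
Proof. by move=> mphi mA; rewrite -[X in measurable X]setTI; exact: mphi. Qed.

(** Induction on the dimension through sections: the section at x of the rescaled set is the
    rescaled section at r x. The outer integral contributes one factor r and the sections contribute
    r^n. *)
Lemma lebesgue_tuple_scale (r : R) n (A : set (n.-tuple M)) : 0 < r ->
  measurable A ->
  (Leb n A = (r ^+ n)%:E * Leb n (@scale_tuple r n @^-1` A))%E.
Proof.
move=> r0; elim: n A => [|n IH] A mA.
  rewrite expr0 mul1e /=; congr (\d_ _ _)%E; apply/seteqP; split => t /=;
  by rewrite (tuple0 t) (tuple0 (scale_tuple _ _)).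
have mB := measurableT_preimage (@measurable_tcons R n) mA.
rewrite /= /lebesgue_step/= /pushforward/= /product_measure1.
set B := @tcons R n @^-1` A in mB *.
have sB x : xsection (@tcons R n @^-1` (@scale_tuple r n.+1 @^-1` A)) x =
    @scale_tuple r n @^-1` (xsection B (r * x)).
  apply/seteqP; split => t; rewrite /xsection/= !inE /= ?inE /B /= scale_tcons//.
set B' := @tcons R n @^-1` (@scale_tuple r n.+1 @^-1` A).
have mB' : measurable B'.
  apply: measurableT_preimage; first exact: measurable_tcons.
  exact: measurableT_preimage (@measurable_scale_tuple r n.+1) mA.
rewrite (ge0_integral_mulr r0); [|exact: (measurable_fun_xsection (Leb n) mB)|by []].
rewrite exprS EFinM -muleA; congr (_ * _)%E.
rewrite -(ge0_integralZl _ _ (measurable_fun_xsection (Leb n) mB'))//; last first.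
  by rewrite lee_fin exprn_ge0// ltW.
by apply: eq_integral => x _; rewrite /= sB -IH//; exact: measurable_xsection.
Qed.

End scaling.

(** * Euclidean norm, punctured balls and the measure of the sphere *)

Section polar_coordinates.
Context {R : realType}.
Local Notation mu := (@lebesgue_measure R).
Local Notation M := (measurableTypeR R).
Local Notation Leb := (lebesgue_tuple R).

Definition tnorm (N : nat) (t : N.-tuple M) : R := enorm (row_of_tuple t).

Lemma tnormE N (t : N.-tuple M) : tnorm t = Num.sqrt (\sum_i tnth t i ^+ 2).
Proof. by congr Num.sqrt; apply: eq_bigr => i _; rewrite mxE. Qed.

Lemma enormZ N (s : R) (x : 'rV[R]_N) : 0 <= s -> enorm (s *: x) = s * enorm x.
Proof.
move=> s0; rewrite /enorm; under eq_bigr => i _ do rewrite mxE exprMn.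
by rewrite -mulr_sumr sqrtrM ?sqr_ge0// sqrtr_sqr ger0_norm.
Qed.

Lemma tnorm_scale N (s : R) (t : N.-tuple M) : 0 <= s ->
  tnorm (scale_tuple s t) = s * tnorm t.
Proof.
move=> s0; rewrite /tnorm -enormZ//; congr enorm.
by apply/rowP => i; rewrite !mxE tnth_scale.
Qed.

Lemma tnorm_ge0 N (t : N.-tuple M) : 0 <= tnorm t.
Proof. exact: sqrtr_ge0. Qed.

Lemma measurable_tnorm N : measurable_fun setT (@tnorm N).
Proof.
rewrite (_ : @tnorm N = Num.sqrt \o (fun t : N.-tuple M => \sum_i tnth t i ^+ 2)).
  apply: measurableT_comp; first by apply: continuous_measurable_fun; exact: sqrt_continuous.
  by apply: measurable_sum => i; apply: measurable_funX; exact: measurable_tnth.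
by apply/funext => t; rewrite tnormE.
Qed.

Lemma tnth_le_tnorm N (t : N.-tuple M) i : `|tnth t i| <= tnorm t.
Proof.
rewrite tnormE -sqrtr_sqr ler_sqrt; last by rewrite sumr_ge0// => j _; exact: sqr_ge0.
by rewrite (bigD1 i)//= lerDl sumr_ge0// => j _; exact: sqr_ge0.
Qed.

(** A bounding box showing that the unit ball has finite measure; its recursion follows that of
    [lebesgue_tuple], so its measure is a product. *)
Fixpoint cube (N : nat) : set (N.-tuple M) :=
  if N is N'.+1 then @tuncons R N' @^-1` (`[-1, 1] `*` @cube N') else setT.

Lemma measurable_cube N : measurable (@cube N).
Proof.
elim: N => [|N IH] /=; first exact: measurableT.
apply: measurableT_preimage; first exact: measurable_tuncons.
exact: measurableX.
Qed.

Lemma cube_finite N : (Leb N (@cube N) < +oo)%E.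
Proof.
elim: N => [|N IH] /=; first by rewrite diracT ltry.
rewrite /lebesgue_step/= /pushforward/= -comp_preimage.
rewrite (_ : @tuncons R N \o @tcons R N = id); last by apply/funext => x; exact: tconsK.
rewrite preimage_id product_measure1E//; last exact: measurable_cube.
have I2 : mu `[-1, 1] = (1 - (-1))%:E.
  by rewrite lebesgue_measure_itv/= lte_fin -subr_gt0 opprK addr_gt0// EFinB.
rewrite [X in (X * _)%E](_ : _ = (1 - (-1) : R)%:E)//.
by rewrite lte_mul_pinfty// lee_fin opprK addr_ge0.
Qed.

Lemma sub_cube N (t : N.-tuple M) : (forall i, `|tnth t i| <= 1) -> cube t.
Proof.
elim: N t => [//|N IH] t t1; split => /=.
  by have := t1 ord0; rewrite in_itv/= ler_norml -[tnth t ord0]/(thead t).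
by apply: IH => i; have := t1 (lift ord0 i); rewrite tnth_behead.
Qed.

(** A punctured ball. The origin is left out so that the shell of radius 1 is exactly the cone over
    the unit sphere, whose scale factors are positive. *)
Definition shell (N : nat) (r : R) : set (N.-tuple M) := [set t | 0 < tnorm t <= r].

Lemma measurable_shell N r : measurable (@shell N r).
Proof.
rewrite (_ : @shell N r = @tnorm N @^-1` `]0, r]).
  apply: measurableT_preimage; first exact: measurable_tnorm.
  exact: measurable_itv.
by apply/seteqP; split => t; rewrite /shell/= in_itv.
Qed.

Lemma shell1_finite N : (Leb N (@shell N 1) < +oo)%E.
Proof.
apply: le_lt_trans (cube_finite N); apply: le_measure; rewrite ?inE.
- exact: measurable_shell.
- exact: measurable_cube.
- by move=> t /andP[_ t1]; apply: sub_cube => i; apply: le_trans t1; exact: tnth_le_tnorm.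
Qed.

Lemma shell_measure N r : (0 < N)%N -> 0 <= r ->
  (Leb N (@shell N r) = (r ^+ N)%:E * Leb N (@shell N 1))%E.
Proof.
move=> N0; rewrite le_eqVlt => /predU1P[<-|r0].
  rewrite expr0n eqn0Ngt N0 mul0e (_ : @shell N 0 = set0) ?measure0//.
  by apply/seteqP; split => t //= /andP[/lt_le_trans]/[apply]; rewrite ltxx.
rewrite (lebesgue_tuple_scale r0 (measurable_shell r)); congr (_ * Leb N _)%E.
apply/seteqP; split => t; rewrite /shell/= tnorm_scale ?(ltW r0)//.
  by rewrite pmulr_rgt0// -ler_pdivlMl// mulVf ?gt_eqF.
by rewrite pmulr_rgt0// -[in r * _ <= r]ler_pdivlMl// mulVf ?gt_eqF.
Qed.

(** A point t off the origin is its norm times a unit vector, which identifies the cone over the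
    sphere with the punctured unit ball. *)
Lemma surface_measure_sphere N :
  surface_measure (unit_sphere R N) = (N%:R%:E * Leb N (@shell N 1))%E.
Proof.
rewrite /surface_measure; congr (_ * Leb N _)%E; apply/seteqP; split => t.
  move=> [x /= x1 [s /andP[s0 s1] ts]]; rewrite /shell/= /tnorm ts enormZ ?(ltW s0)//.
  by rewrite x1 mulr1 s0.
move=> /andP[t0 t1]; exists ((tnorm t)^-1 *: row_of_tuple t) => /=.
  by rewrite /unit_sphere/= enormZ ?invr_ge0 ?tnorm_ge0// mulVf// gt_eqF.
by exists (tnorm t); rewrite ?t0// scalerA divff ?gt_eqF// scale1r.
Qed.

End polar_coordinates.

(** * Integration of radial functions *)

Section polar_integration.
Context {R : realType}.
Variable N : nat.
Implicit Types (r s x y a b c : R).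
Hypothesis N0 : (0 < N)%N.
Local Notation mu := (@lebesgue_measure R).
Local Notation M := (measurableTypeR R).
Local Notation Leb := (lebesgue_tuple R N).

Let root (s : R) := s `^ N%:R^-1.

Let rootK s : 0 <= s -> root s ^+ N = s.
Proof.
move=> s0; rewrite /root -powR_mulrn ?powR_ge0// -powRrM mulVf ?powRr1//.
by rewrite pnatr_eq0 -lt0n.
Qed.

Let root_ge0 s : 0 <= root s. Proof. exact: powR_ge0. Qed.

Let rootX r : 0 <= r -> root (r ^+ N) = r.
Proof.
by move=> r0; apply/eqP; rewrite -(eqrXn2 N0)// rootK// exprn_ge0.
Qed.

Let is_derive_root s : 0 < s -> is_derive s 1 root (N%:R^-1 * s `^ (N%:R^-1 - 1)).
Proof. exact: is_derive1_powR. Qed.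

Let phi (t : N.-tuple M) : M := tnorm t ^+ N.

Let mphi : measurable_fun setT phi.
Proof. by apply: measurable_funX; exact: measurable_tnorm. Qed.

Let omega : {nonneg R} := NngNum (fine_ge0 (measure_ge0 Leb (@shell R N 1))).

Let omegaE : (Leb (@shell R N 1) = omega%:num%:E)%E.
Proof. by rewrite /= fineK// ge0_fin_numE//; exact: shell1_finite. Qed.

(** The preimage is the difference of two punctured balls whose radii are the N-th roots of b and c;
    by scaling their volumes are proportional to b and c. *)
Let phi_itv c b : 0 <= c -> c <= b ->
  (Leb (phi @^-1` `]c, b]) = (omega%:num * (b - c))%:E)%E.
Proof.
move=> c0 cb; have b0 := le_trans c0 cb.
have leE s (t : N.-tuple M) : 0 <= s -> (tnorm t <= root s) = (phi t <= s).
  by move=> s0; rewrite -{2}(rootK s0) /phi ler_pXn2r ?nnegrE ?tnorm_ge0.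
have shE (s : R) : 0 <= s -> (Leb (@shell R N (root s)) = (omega%:num * s)%:E)%E.
  by move=> s0; rewrite shell_measure// rootK// omegaE -EFinM mulrC.
have -> : phi @^-1` `]c, b] = @shell R N (root b) `\` @shell R N (root c).
  apply/seteqP; split => t; rewrite /shell/= in_itv/= !leE//.
    move=> /andP[ct tb]; split; last by rewrite leNgt ct andbF.
    rewrite tb andbT lt_neqAle tnorm_ge0 andbT eq_sym; apply/eqP => t0.
    by move: ct; rewrite /phi t0 expr0n eqn0Ngt N0 ltNge c0.
  by move=> [/andP[t0 tb]] /negP; rewrite t0/= -ltNge tb andbT.
have fb : (Leb (@shell R N (root b)) < +oo)%E by rewrite shE// ltry.
have := measureD (measurable_shell (root b)) (measurable_shell (root c)) fb.
move=> /= ->; rewrite (_ : _ `&` _ = @shell R N (root c)); last first.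
  apply/setIidr => t; rewrite /shell/= !leE// => /andP[-> tc]/=.
  exact: le_trans tc cb.
by rewrite !shE// -EFinB mulrBr.
Qed.

(* By scaling, t |-> |t|^N pushes Lebesgue measure on R^N forward to a multiple of
   the one on ]0, +oo[; the density r^(N-1) then comes from substituting r^N. *)
Lemma tnorm_power_measure (A : set M) : measurable A -> A `<=` `]0, +oo[ ->
  (Leb (phi @^-1` A) = omega%:num%:E * mu A)%E.
Proof.
move=> mA A0; have mD : measurable (`]0, +oo[ : set M) := measurable_itv _.
(* Both measures are restricted to the positive half-line: the pushforward does not charge negative
   numbers, so only then do the two agree on every half-open interval. *)
pose m1 : {measure set M -> \bar R} := mrestr (pushforward_measure mphi Leb) mD.
pose m2 : {measure set M -> \bar R} := mscale omega (mrestr mu mD).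
have m1D B : m1 B = Leb (phi @^-1` (B `&` `]0, +oo[)) by [].
have m2D B : (m2 B = omega%:num%:E * mu (B `&` `]0%R, +oo[))%E by [].
suff : m1 A = m2 A by rewrite m1D m2D (setIidl A0).
have m1E (a b : R) : m1 `]a, b] = m2 `]a, b].
  rewrite m1D m2D.
  have -> : `]a, b] `&` `]0, +oo[ = `]Num.max a 0, b]%classic.
    apply/seteqP; split => r; rewrite /= !in_itv/= gt_max andbT.
      by move=> [/andP[-> ->] ->].
    by move=> /andP[/andP[-> ->] ->].
  rewrite lebesgue_measure_itv/= lte_fin; set c := Num.max a 0.
  have c0 : 0 <= c by rewrite le_max lexx orbT.
  case: ltP => cb.
    by rewrite phi_itv ?(ltW cb)// EFinM.
  rewrite (_ : `]c, b]%classic = set0) ?preimage_set0 ?measure0 ?mule0//.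
  apply/seteqP; split => r //=; rewrite in_itv/= => /andP[/lt_le_trans]/[apply].
  by rewrite ltNge cb.
(* Half-open intervals generate the sigma-algebra and are closed under intersection; the intervals
   ]-k, k] cover the line with finite measure. *)
have uniq := @measure_unique _ R M (@ocitv R)
  (fun k : nat => `]- k%:R, k%:R]%classic) erefl (@ocitvI R).
apply: (uniq _ _ m1 m2 _ _ A mA).
- by move=> k; exists (- k%:R, k%:R).
- apply/seteqP; split => // r _; exists (Num.truncn `|r|).+1 => //=.
  by rewrite in_itv/=; have := truncnS_gt `|r|; rewrite ltr_norml => /andP[-> /ltW ->].
- by move=> _ [[a b] _ <-]; exact: m1E.
- move=> k; rewrite m1E m2D.
  apply: lte_mul_pinfty; rewrite ?lee_fin//.
  apply: (@le_lt_trans _ _ (mu `]- k%:R, k%:R]%classic)).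
    by apply: le_measure; rewrite ?inE//; exact: measurableI.
  by rewrite lebesgue_measure_itv/=; case: ifP => // _; rewrite -EFinB ltry.
Qed.

(** Pushing forward by the N-th power of the norm gives a multiple of the integral of f(s^(1/N)) ds,
    and s = r^N then produces N r^(N-1) dr. Working on [x, y] with x > 0 keeps away from 0, where f
    is not controlled. *)
Lemma polar_itv (f : R -> R) x y : smooth_on_pos f -> (forall r, 0 < r -> 0 <= f r) ->
  0 < x -> x <= y ->
  (\int[Leb]_(t in (@tnorm R N) @^-1` `[x, y]) (f (tnorm t))%:E =
   N%:R%:E * Leb (@shell R N 1) * \int[mu]_(r in `[x, y]) (f r * r ^+ (N - 1))%:E)%E.
Proof.
move=> sf f0 x0 xy; have y0 := lt_le_trans x0 xy.
pose F (r : R) := r ^+ N; pose G (s : R) := f (root s).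
have Fle (r s : R) : 0 <= r -> 0 <= s -> (F r <= F s) = (r <= s).
  by move=> r0 s0; rewrite /F ler_pXn2r.
have Fx0 : 0 < F x by rewrite exprn_gt0.
have pos (s : R) : F x <= s -> 0 < s by exact: lt_le_trans.
have dG (s : R) : 0 < s -> derivable G s 1.
  move=> s0; apply: is_derive_ex; apply: is_derive1_comp; last exact: is_derive_root.
  by apply: smooth_is_derive => //; rewrite powR_gt0.
have cG : {within `[F x, F y], continuous G}.
  by apply: derivable_within_continuous => s; rewrite in_itv/= => /andP[/pos s0 _]; exact: dG.
have mG : measurable_fun `[F x, F y] G by exact: subspace_continuous_measurable_fun.
have G0 (s : R) : 0 < s -> 0 <= G s by move=> s0; apply: f0; rewrite powR_gt0.
transitivity (\int[pushforward_measure mphi Leb]_(s in `[F x, F y]) (G s)%:E)%E.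
  rewrite (ge0_integral_pushforward mphi)//=; last 2 first.
    exact/measurable_EFinP.
    by move=> s; rewrite inE/= in_itv/= lee_fin => /andP[/pos s0 _]; exact: G0.
  rewrite (_ : phi @^-1` _ = (@tnorm R N) @^-1` `[x, y]).
    by apply: eq_integral => t _; rewrite /G /phi rootX// tnorm_ge0.
  by apply/seteqP; split => t /=; rewrite !in_itv/= /phi !Fle ?tnorm_ge0// ltW.
transitivity (\int[mscale omega mu]_(s in `[F x, F y]) (G s)%:E)%E.
  apply: eq_measure_integral => A mA AF; apply: tnorm_power_measure => //.
  by move=> s /AF/=; rewrite !in_itv/= andbT => /andP[/pos].
rewrite ge0_integral_mscale//; last 2 first.
  exact/measurable_EFinP.
  by move=> s /=; rewrite in_itv/= lee_fin => /andP[/pos s0 _]; exact: G0.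
have sF : smooth_on_pos F by exact: smoothX.
have dF (r : R) : F^`()%classic r = N%:R * r ^+ (N - 1).
  by rewrite (derive1_val (is_deriveXr N r)) subn1.
have sF' := smooth_derive1 sF.
(* Substitution s = r^N, increasing on [x, y]; the goals that follow are its regularity
   conditions. *)
rewrite (integration_by_substitution_increasing xy); last first.
- exact: cG.
- split.
  + move=> r; rewrite in_itv/= => /andP[xr _]; apply: smooth_derivable sF _.
    exact: lt_trans xr.
  + by apply: cvg_at_right_filter; exact: smooth_continuous.
  + by apply: cvg_at_left_filter; exact: smooth_continuous.
- apply/cvg_ex; exists (F^`()%classic y); apply: cvg_at_left_filter.
  exact: smooth_continuous.
- apply/cvg_ex; exists (F^`()%classic x); apply: cvg_at_right_filter.
  exact: smooth_continuous.
- move=> r; rewrite in_itv/= => /andP[xr _]; apply: smooth_continuous sF' _.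
  exact: lt_trans xr.
- move=> r s; rewrite !in_itv/= => /andP[xr _] /andP[xs _].
  by rewrite /F ltr_pXn2r// nnegrE ltW// (lt_le_trans x0).
rewrite omegaE [(N%:R%:E * _)%E]muleC -muleA; congr (_ * _)%E.
rewrite -ge0_integralZl//=; last 2 first.
- have mfr : measurable_fun `[x, y] (EFin \o (fun r => f r * r ^+ (N - 1))).
    apply: EFin_smooth_measurable; [|exact: measurable_itv|].
      exact: smoothM sf (smoothX (n := N - 1)).
    by move=> r /=; rewrite !in_itv/= andbT => /andP[/(lt_le_trans x0)].
  exact: mfr.
- move=> r; rewrite /= in_itv/= => /andP[/(lt_le_trans x0) r0 _].
  by rewrite lee_fin mulr_ge0 ?f0// exprn_ge0// ltW.
apply: eq_integral => r; rewrite inE/= in_itv/= => /andP[/(lt_le_trans x0) r0 _].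
by rewrite -EFinM fctE/= dF /G rootX ?ltW// mulrCA.
Qed.

(** A lower bound follows from restricting the integral to closed shells avoiding the origin and
    letting them grow. The common value [c] where the norm is zero makes [F] measurable. *)
Lemma polar_ge (f : R -> R) (F : N.-tuple M -> R) c : smooth_on_pos f ->
  (forall r, 0 < r -> 0 <= f r) ->
  (forall t, 0 <= F t) ->
  (forall t, 0 < tnorm t -> F t = f (tnorm t)) ->
  (forall t, tnorm t = 0 -> F t = c) ->
  (surface_measure (unit_sphere R N) *
     \int[mu]_(r in `]0%R, +oo[) (f r * r ^+ (N - 1))%:E <=
   \int[Leb]_t (F t)%:E)%E.
Proof.
move=> sf f0 F0 Ff Fc; rewrite surface_measure_sphere.
have sfr := smoothM sf (smoothX (n := N - 1)).
have fr0 r : 0 < r -> 0 <= f r * r ^+ (N - 1).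
  by move=> r0; rewrite mulr_ge0 ?f0// exprn_ge0// ltW.
have mtn (A : set M) : measurable A -> measurable ((@tnorm R N) @^-1` A).
  by move=> mA; apply: measurableT_preimage mA; exact: measurable_tnorm.
have mF : measurable_fun setT (fun t => (F t)%:E).
  apply/measurable_EFinP.
  have -> : setT = (@tnorm R N) @^-1` `]0, +oo[ `|` (@tnorm R N) @^-1` [set 0].
    apply/esym/seteqP; split => // t _; have := tnorm_ge0 t.
    by rewrite le_eqVlt => /predU1P[t0|t0]; [right|left; rewrite /= in_itv/= t0].
  have mpos := mtn _ (measurable_itv `]0, +oo[%R); have mzero := mtn _ (measurable_set1 0).
  apply/(measurable_funU _ mpos mzero); split.
    apply: (eq_measurable_fun (f \o (@tnorm R N))).
      by move=> t; rewrite inE/= in_itv/= andbT => /Ff.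
    apply: (@measurable_comp _ _ _ _ _ _ (`]0, +oo[ : set M)).
    - exact: measurable_itv.
    - by move=> _ [t /= t0 <-].
    - by apply: smooth_measurable.
    - by apply: measurable_funTS; exact: measurable_tnorm.
  apply: (eq_measurable_fun (cst c)); last exact: measurable_cst.
  by move=> t; rewrite inE => /Fc.
have cv : (N%:R%:E * Leb (@shell R N 1) *
    \int[mu]_(r in exhaust k) (f r * r ^+ (N - 1))%:E @[k --> \oo] -->
    N%:R%:E * Leb (@shell R N 1) *
    \int[mu]_(r in `]0%R, +oo[) (f r * r ^+ (N - 1))%:E)%E.
  apply: cvgeZl; last exact: cvg_exhaust sfr fr0.
  by rewrite fin_numM// omegaE.
rewrite -(cvg_lim _ cv)//; apply: lime_le; first by apply/cvg_ex; eexists; exact: cv.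
apply: nearW => k; have x0 : 0 < k.+1%:R^-1 :> R by rewrite invr_gt0 ltr0n.
rewrite /exhaust -(polar_itv sf f0 x0 (ltW (lt_natSinv_natSS k))).
rewrite (eq_integral (fun t => (F t)%:E)); last first.
  move=> t; rewrite inE /= in_itv/= => /andP[/(lt_le_trans x0) t0 _].
  by rewrite Ff.
apply: ge0_subset_integral => //; first exact: mtn (measurable_itv _).
by move=> t _; rewrite lee_fin.
Qed.

End polar_integration.

(** * Transfer of the radial inequality to R^N *)

Section assembly.
Context {R : realType}.

(** For r < 1 the weight r^N is the square of r^(N/2), hence at most r^(N/2). *)
Lemma cvg0_powR (N : nat) (f : R -> R) :
  f r * r `^ (N%:R / 2) @[r --> 0^'+] --> (0 : R) ->
  r ^+ N * f r @[r --> 0^'+] --> (0 : R).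
Proof.
move=> cf; apply/cvgr0Pnorm_le => e e0.
have fe := cvgr0_norm_le _ cf _ e0.
near=> r.
have r0 : 0 < r by near: r; exact: nbhs_right_gt.
have r1 : r < 1 by near: r; exact: nbhs_right_lt.
apply: (@le_trans _ _ `|f r * r `^ (N%:R / 2)|); last by near: r; exact: fe.
have sq : r ^+ N = r `^ (N%:R / 2) * r `^ (N%:R / 2).
  rewrite -powRD; last by rewrite (gt_eqF r0) implybT.
  by rewrite -splitr powR_mulrn ?ltW.
rewrite sq mulrC mulrA normrM ler_piMr// ger0_norm ?powR_ge0//.
by rewrite -[leRHS](powRr0 r); apply: ger_powR; [rewrite r0 ltW|exact: divr_ge0].
Unshelve. all: by end_near. Qed.

Lemma enorm_eq0 N (x : 'rV[R]_N) : enorm x = 0 -> x = 0.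
Proof.
move=> /(congr1 (fun s => s ^+ 2)); rewrite enorm_sqr expr0n/= => x0.
apply/rowP => i; rewrite mxE; apply/eqP; rewrite -sqrf_eq0; apply/eqP.
by apply: (psumr_eq0P _ x0) => // j _; exact: sqr_ge0.
Qed.

Lemma radial_integral_ge N (f : R -> R) (F : 'rV[R]_N -> R) : (0 < N)%N ->
  smooth_on_pos f -> (forall x, 0 <= F x) ->
  (forall x, 0 < enorm x -> F x = f (enorm x) ^+ 2) ->
  (surface_measure (unit_sphere R N) *
     \int[lebesgue_measure]_(r in `]0%R, +oo[) (f r ^+ 2 * r ^+ (N - 1))%:E <=
   \int[lebesgue_tuple R N]_t (F (row_of_tuple t))%:E)%E.
Proof.
move=> N0 sf F0 Ff; apply: (polar_ge (c := F 0) N0 (smooth_sqr sf)) => //.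
- by move=> r _; exact: sqr_ge0.
- by move=> t t0; exact: Ff.
- by move=> t /enorm_eq0 ->.
Qed.

(** Common form of both claims: [j = 0] for the iterated Laplacian and [j = 1] for its gradient. [F]
    stands for the integrand, prescribed only off the origin. *)
Lemma radial_rellich N m j (U : R -> R) (F : 'rV[R]_N -> R) :
  (0 < m)%N -> (m.*2 + j <= N.+1)%N -> (0 < N)%N -> smooth_on_pos U ->
  (dslope U)^`(m.*2 + j - 2)%classic r * r `^ (N%:R / 2) @[r --> 0^'+] --> (0 : R) ->
  (forall x, 0 <= F x) ->
  (forall x, 0 < enorm x -> F x = (iter m (radlap N) U)^`(j)%classic (enorm x) ^+ 2) ->
  (surface_measure (unit_sphere R N) *
     \int[lebesgue_measure]_(r in `]0%R, +oo[)
       (`|U^`(m.*2 + j)%classic r| ^+ 2 * r ^+ (N - 1))%:E <=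
   \int[lebesgue_tuple R N]_t (F (row_of_tuple t))%:E)%E.
Proof.
move=> m0 KN N0 sU /cvg0_powR cV F0 FW.
have sW : smooth_on_pos (iter m (radlap N) U)^`(j).
  by apply: smooth_derive1n; exact: smooth_iter_radlap.
apply: le_trans (radial_integral_ge N0 sW F0 FW).
apply: lee_wpmul2l; first by rewrite surface_measure_sphere mule_ge0.
under eq_integral => r _ do rewrite real_normK ?num_real//.
exact: iter_radlap_integral_le.
Qed.

End assembly.

Unset Implicit Arguments.

Theorem theorem1p3 (R : realType) (N m : nat) (U : R -> R)
    (hN : (1 <= N)%N) (hm : (1 <= m)%N) (hU : smooth_on_pos U) :
  ((2 * m - 1 <= N)%N ->
   (fun s : R => U^`()%classic s / s)^`(2 * m - 2)%classic r * r `^ (N%:R / 2)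
     @[r --> 0^'+] --> (0 : R) ->
   (fun s : R => U^`()%classic s / s)^`(2 * m - 2)%classic r * r `^ (N%:R / 2)
     @[r --> +oo] --> (0 : R) ->
   (\int[lebesgue_tuple R N]_t
       (`|iter m (@laplacian R N) (radial U) (row_of_tuple t)| ^+ 2)%:E >=
    surface_measure (unit_sphere R N) *
    \int[lebesgue_measure]_(r in `]0%R, +oo[)
       (`|U^`(2 * m)%classic r| ^+ 2 * r ^+ (N - 1))%:E)%E)
  /\
  ((2 * m <= N)%N ->
   (fun s : R => U^`()%classic s / s)^`(2 * m - 1)%classic r * r `^ (N%:R / 2)
     @[r --> 0^'+] --> (0 : R) ->
   (fun s : R => U^`()%classic s / s)^`(2 * m - 1)%classic r * r `^ (N%:R / 2)
     @[r --> +oo] --> (0 : R) ->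
   (\int[lebesgue_tuple R N]_t
       (enorm (grad (iter m (@laplacian R N) (radial U)) (row_of_tuple t))
          ^+ 2)%:E >=
    surface_measure (unit_sphere R N) *
    \int[lebesgue_measure]_(r in `]0%R, +oo[)
       (`|U^`(2 * m + 1)%classic r| ^+ 2 * r ^+ (N - 1))%:E)%E).
Proof.
have lapE x : 0 < enorm x -> iter m (@laplacian R N) (radial U) x =
    radial (iter m (radlap N) U) x by exact: iter_laplacian_radial.
have sW : smooth_on_pos (iter m (radlap N) U) by exact: smooth_iter_radlap.
split=> NK V0 _.
(* Here [j = 0], and 2m - 1 <= N is the dimension condition 2m + j <= N + 1. *)
- have -> : (2 * m = m.*2 + 0)%N by rewrite addn0 mul2n.
  apply: (radial_rellich
    (F := fun x => `|iter m (@laplacian R N) (radial U) x| ^+ 2) hm _ hN hU).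
  + by lia.
  + by rewrite addn0 -mul2n; exact: V0.
  + by move=> x; rewrite sqr_ge0.
  + by move=> x x0; rewrite lapE// real_normK ?num_real.
(* Here [j = 1]: off the origin the squared gradient norm is the square of the first derivative of
   the profile L^m U. *)
- have -> : (2 * m + 1 = m.*2 + 1)%N by rewrite mul2n.
  apply: (radial_rellich
    (F := fun x => enorm (grad (iter m (@laplacian R N) (radial U)) x) ^+ 2) hm _ hN hU).
  + by lia.
  + by rewrite (_ : m.*2 + 1 - 2 = 2 * m - 1)%N; [exact: V0|lia].
  + by move=> x; rewrite sqr_ge0.
  + by move=> x x0; exact: enorm_grad_radial.
Qed.
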